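(* Let $\pi_1:V_1\to X_1$ and $\pi_2:V_2\to X_2$ be two diffeological vector pseudo-bundles (with finite-dimensional fibres), let $f:Y\to X_2$ be a smooth injective map defined on a subset $Y\subset X_1$, and let $\tilde f:\pi_1^{-1}(Y)\to\pi_2^{-1}(f(Y))$ be a smooth fibrewise linear lift of $f$. Suppose that the restrictions of the dual pseudo-bundles $\pi_1^*:V_1^*\to X_1$ and $\pi_2^*:V_2^*\to X_2$ to $Y$ and $f(Y)$ respectively are diffeomorphic. Then the dual map $\tilde f^*:(\pi_2^{-1}(f(Y)))^*\to(\pi_1^{-1}(Y))^*$ is a smooth fibrewise linear lift of the map $f^{-1}:f(Y)\to Y$ to the dual pseudo-bundles $\pi_2^*:V_2^*\to X_2$ and $\pi_1^*:V_1^*\to X_1$, and the following two pseudo-bundles are diffeomorphic as pseudo-bundles: $$\pi^*:(V_1\cup_{\tilde f}V_2)^*\to X_1\cup_fX_2\quad\text{and}\quad \pi_2^*\cup_{(\tilde f^*,f^{-1})}\pi_1^*:V_2^*\cup_{\tilde f^*}V_1^*\to X_2\cup_{f^{-1}}X_1 .$$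
   Context: Diffeological spaces, smooth maps, and the subset, product, sum and quotient diffeologies are the standard ones (plots of a subset: plots of the ambient space with image in it; plots of a product: pairs of plots; plots of a disjoint sum: maps that are locally plots of one summand; plots of a quotient: maps that locally lift to plots). Diffeological vector pseudo-bundle: a smooth map $\pi:V\to X$ of diffeological spaces such that each fibre carries a real vector space structure and the fibrewise addition $V\times_XV\to V$, the scalar multiplication $\mathbb{R}\times V\to V$, and the zero section $X\to V$ are smooth ($V\times_XV\subset V\times V$ with the subset diffeology, $\mathbb{R}$ standard). Gluing: for $Y\subset X_1$ and a smooth $f:Y\to X_2$, $X_1\cup_fX_2$ is the quotient of $X_1\sqcup X_2$ by the relation generated by $y\sim f(y)$, with the quotient of the sum diffeology. A smooth fibrewise linear lift of $f$ is a smooth map $\tilde f:\pi_1^{-1}(Y)\to\pi_2^{-1}(f(Y))$, linear on each fibre, with $\pi_2\circ\tilde f=f\circ\pi_1$ on $\pi_1^{-1}(Y)$. Gluing the pseudo-bundles along $(\tilde f,f)$ gives the induced map $\pi:V_1\cup_{\tilde f}V_2\to X_1\cup_fX_2$ (also written $\pi_1\cup_{(\tilde f,f)}\pi_2$), with fibres over points of $X_1\setminus Y$ having the vector space structure from $\pi_1$ and all others that from $\pi_2$. Dual pseudo-bundle: for a pseudo-bundle $\pi:V\to X$, $V^*=\bigcup_{x\in X}(\pi^{-1}(x))^*$, where $(\pi^{-1}(x))^*$ is the diffeological dual, i.e. the space of smooth linear maps $\pi^{-1}(x)\to\mathbb{R}$, and $\pi^*:V^*\to X$ is the obvious projection. A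 map $p:U\to V^*$ ($U$ a domain in some $\mathbb{R}^l$) is a plot of the dual bundle diffeology iff $\pi^*\circ p$ is a plot of $X$ and, for every plot $q:U'\to V$, the map $(u,u')\mapsto p(u)(q(u'))$ on $Y'=\{(u,u')\in U\times U' : \pi^*(p(u))=\pi(q(u'))\}$ is smooth for the subset diffeology of $Y'$ and the standard diffeology of $\mathbb{R}$. The spaces $(\pi_2^{-1}(f(Y)))^*$ and $(\pi_1^{-1}(Y))^*$ denote the parts $(\pi_2^* )^{-1}(f(Y))\subset V_2^*$ and $(\pi_1^* )^{-1}(Y)\subset V_1^*$; the dual map $\tilde f^*$ is given fibrewise by $\tilde f^*(v_2^* )(w_1)=v_2^*(\tilde f(w_1))$ for $v_2^*\in(\pi_2^{-1}(f(y)))^*$, $w_1\in\pi_1^{-1}(y)$, $y\in Y$. Two pseudo-bundles are diffeomorphic (as pseudo-bundles) if there is a diffeomorphism of total spaces, linear on fibres, covering a diffeomorphism of the bases.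
   Formalization: The restricted dual pseudo-bundles are assumed diffeomorphic through the dual map f~* itself (the diffeomorphism is inverse to f~* ), not by an arbitrary diffeomorphism; with an arbitrary one the claim fails, e.g. X1=R, Y={0}, V1=R×R, X2 a point, V2=R, f~=0. *)

(* Defs.v *)
From HB Require Import structures.
From Stdlib Require Relation_Operators.
From mathcomp Require Import all_boot all_order all_algebra.
From mathcomp Require Import all_classical all_reals.
From mathcomp Require Import topology normedtype landau derive.
Set Implicit Arguments. Unset Strict Implicit. Unset Printing Implicit Defensive.
Import Order.TTheory GRing.Theory Num.Theory.
Import numFieldNormedType.Exports.
Local Open Scope classical_set_scope.
Local Open Scope ring_scope.

Section Smooth.
Variable R : realType.

(* f is C^k at every point of U: differentiable up to order k, with all the
   iterated directional derivatives of order at most k continuous.  Only the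
   values of f near U matter, and U is open wherever this is used. *)
Fixpoint Ck (k : nat) (V W : normedModType R) (U : set V) (f : V -> W) : Prop :=
  if k is k'.+1 then
    (forall x, U x -> differentiable f x) /\ forall v, Ck k' U ('D_v f)
  else forall x, U x -> {for x, continuous f}.

Definition Cinfty (V W : normedModType R) (U : set V) (f : V -> W) : Prop :=
  forall k, Ck k U f.

Implicit Types V W : normedModType R.

Lemma near_eq_differentiable V W (f g : V -> W) x :
  {near x, f =1 g} -> differentiable f x -> differentiable g x.
Proof.
move=> fg df.
have [dc e] := (diff_locallyP x f).1 df.
have e' : g \o shift x = cst (g x) + 'd f x +o_ 0 id.
  apply/eqaddoP => eps eps0.
  have /eqaddoP /(_ eps eps0) H := e.
  have : \forall h \near (0 : V), f (h + x) = g (h + x).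
    by move: fg; rewrite (near_shift 0)/= subr0.
  move=> H2; near=> h.
  have <- : (f \o shift x - (cst (f x) + 'd f x)) h =
            (g \o shift x - (cst (g x) + 'd f x)) h.
    rewrite /= !fctE /= (nbhs_singleton fg); congr (_ - _).
    by near: h.
  by near: h.
have de := diff_unique dc e'.
by apply/diff_locallyP; rewrite de.
Unshelve. all: by end_near. Qed.

Lemma Ck_eq k V W (U : set V) (f g : V -> W) : open U ->
  (forall x, U x -> f x = g x) -> Ck k U f -> Ck k U g.
Proof.
move=> oU; elim: k f g => [|k IH] f g fg /=.
  move=> cf x Ux; have n : {near x, g =1 f}.
    by apply: filterS (open_nbhs_nbhs (conj oU Ux)) => y Uy; rewrite fg.
  suff: g @ x --> g x by [].
  rewrite -(fg _ Ux).
  apply: cvg_trans (cf x Ux); apply: near_eq_cvg.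
  by apply: filterS n => y ->.
have n x : U x -> {near x, f =1 g}.
  by move=> Ux; apply: filterS (open_nbhs_nbhs (conj oU Ux)) => y Uy; rewrite fg.
move=> [df Df]; split=> [x Ux|v].
  by apply: near_eq_differentiable (df _ Ux); exact: n.
by apply: IH (Df v) => x Ux; apply: near_eq_derive; exact: n.
Qed.

Lemma CkW k V W (U : set V) (f : V -> W) : Ck k.+1 U f -> Ck k U f.
Proof.
elim: k f => [|k IH] f /=.
  by move=> [df _] x Ux; apply: differentiable_continuous; exact: df.
by move=> [df Df]; split=> // v; apply: IH; exact: Df.
Qed.

Lemma Ck_sub k V W (U U' : set V) (f : V -> W) : U' `<=` U -> Ck k U f -> Ck k U' f.
Proof.
move=> s; elim: k f => [|k IH] f /=; first by move=> h x /s; exact: h.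
by move=> [df Df]; split=> [x /s|v]; [exact: df|exact: IH].
Qed.

Lemma Ck_local k V W (U : set V) (f : V -> W) :
  (forall x, U x -> exists2 U', [/\ open U' & U' x] & Ck k U' f) -> Ck k U f.
Proof.
elim: k f => [|k IH] f h /=; first by move=> x /h [U' [_ U'x]]; exact.
split=> [x /h[U' [_ U'x] [d _]]|v]; first exact: (d x U'x).
by apply: IH => x /h[U' oU' [_ D]]; exists U' => //; apply: D.
Qed.

Lemma Ck_cst k V W (U : set V) (c : W) : Ck k U (fun=> c).
Proof.
elim: k c => [|k IH] c /=; first by move=> x _; exact: cvg_cst.
split=> [x _|v]; first exact: differentiable_cst.
by rewrite (_ : 'D_v _ = fun=> 0) //; apply/funext => x; rewrite derive_cst.
Qed.

Lemma CkD k V W (U : set V) (f g : V -> W) : open U ->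
  Ck k U f -> Ck k U g -> Ck k U (f + g).
Proof.
move=> oU; elim: k f g => [|k IH] f g /=.
  by move=> cf cg x Ux; apply: continuousD; [exact: cf|exact: cg].
move=> [df Df] [dg Dg]; split=> [x Ux|v].
  by apply: differentiableD; [exact: df|exact: dg].
apply: (@Ck_eq _ _ _ _ ('D_v f + 'D_v g)) => //; last exact: IH.
move=> x Ux; rewrite deriveD //; apply: diff_derivable; [exact: df|exact: dg].
Qed.

Lemma Ck_sum k V W (U : set V) n (f : 'I_n -> V -> W) : open U ->
  (forall i, Ck k U (f i)) -> Ck k U (\sum_(i < n) f i).
Proof.
move=> oU h; elim/big_ind : _ => //; first exact: Ck_cst.
by move=> ? ?; exact: CkD.
Qed.

Lemma scale_bilinear W : bilinear_for
  (GRing.Scale.Law.clone _ _ *:%R _) (GRing.Scale.Law.clone _ _ *:%R _)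
  (@GRing.scale R W).
Proof.
split=> [u'|u] a x y /=; first by rewrite scalerDl scalerA.
by rewrite scalerDr !scalerA mulrC.
Qed.
HB.instance Definition _ W :=
  bilinear_isBilinear.Build R R W W _ _ (@GRing.scale R W) (@scale_bilinear W).

Lemma diffZ_fct V W (r : V -> R) (f : V -> W) x :
  differentiable r x -> differentiable f x ->
  is_diff x (fun y => r y *: f y) (fun v => r x *: 'd f x v + 'd r x v *: f x).
Proof.
move=> dr df.
have bc : continuous (fun p : R * W => p.1 *: p.2) by move=> ?; exact: scale_continuous.
have dp : differentiable (fun y => (r y, f y)) x by exact: differentiable_pair.
have db : differentiable (fun p : R * W => p.1 *: p.2) (r x, f x).
  exact: (differentiable_bilin (f := @GRing.scale R W)).
apply: DiffDef; first exact: (differentiable_comp dp db).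
rewrite (diff_comp dp db) (diff_bilin (f := @GRing.scale R W)) // diff_pair //.
Qed.

Lemma CkZ k V W (U : set V) (r : V -> R) (f : V -> W) : open U ->
  Ck k U r -> Ck k U f -> Ck k U (fun x => r x *: f x).
Proof.
move=> oU; elim: k r f => [|k IH] r f.
  move=> cr cf x Ux; apply: cvgZ; [exact: cr|exact: cf].
move=> hr hf; have /= [dr Dr] := hr; have /= [df Df] := hf.
split=> [x Ux|v].
  by case: (diffZ_fct (dr x Ux) (df x Ux)).
apply: (@Ck_eq _ _ _ _ ((fun x => r x *: 'D_v f x) + (fun x => 'D_v r x *: f x))) => //.
  move=> x Ux; have [h1 h2] := diffZ_fct (dr x Ux) (df x Ux).
  rewrite (deriveE _ h1) h2 -[LHS]/(r x *: 'D_v f x + 'D_v r x *: f x).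
  by rewrite (deriveE _ (dr x Ux)) (deriveE _ (df x Ux)).
by apply: CkD => //; apply: IH => //; exact: CkW.
Qed.

Lemma Ck_lin k V W W' (U : set V) (L : {linear W -> W'}) (f : V -> W) :
  open U -> continuous L -> Ck k U f -> Ck k U (L \o f).
Proof.
move=> oU cL; elim: k f => [|k IH] f /=.
  by move=> cf x Ux; apply: continuous_comp; [exact: cf|exact: cL].
move=> [df Df]; have dL x : differentiable (L : W -> W') x by exact: linear_differentiable.
  have dLf x : U x -> differentiable ((L : W -> W') \o f) x.
    by move=> Ux; apply: (@differentiable_comp R V W W' f L x) => //; exact: df.
split=> [x Ux|v]; first exact: dLf.
apply: (@Ck_eq _ _ _ _ (L \o 'D_v f)) => //; last exact: IH.
move=> x Ux /=; rewrite [RHS]deriveE; last exact: dLf.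
by rewrite (@diff_comp R V W W' f L x) //= ?diff_lin // ?(deriveE _ (df x Ux)) //; exact: df.
Qed.

Lemma Ck_coord k V n (U : set V) (g : V -> 'rV[R]_n) i :
  open U -> Ck k U g -> Ck k U (fun x => g x ord0 i).
Proof.
move=> oU hg.
have @L : {linear 'rV[R]_n -> R}.
  by exists (fun N : 'rV[R]_n => N ord0 i); do 2![eexists]; do ?[constructor];
     rewrite ?mxE// => ? *; rewrite ?mxE//; move=> ?; rewrite !mxE.
apply: (@Ck_lin k V _ _ U L g) => //.
exact: coord_continuous.
Qed.

Lemma Ck_comp k V n W (U : set 'rV[R]_n) (U' : set V) (f : 'rV[R]_n -> W)
    (g : V -> 'rV[R]_n) :
  open U' -> (forall x, U' x -> U (g x)) ->
  Ck k U f -> Ck k U' g -> Ck k U' (f \o g).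
Proof.
move=> oU' UU'; elim: k f => [|k IH] f.
  by move=> cf cg x Ux; apply: continuous_comp; [exact: cg|apply: cf; exact: UU'].
move=> hf hg; have /= [df Df] := hf; have /= [dg Dg] := hg.
have dfg x : U' x -> differentiable (f \o g) x.
  by move=> Ux; apply: differentiable_comp; [exact: dg|apply: df; exact: UU'].
split=> // v.
pose F i x := ('D_v g x) ord0 i *: ('D_(delta_mx ord0 i) f (g x)).
apply: (@Ck_eq _ _ _ _ (\sum_i F i)) => //; last first.
  apply: Ck_sum => // i; apply: CkZ => //; first exact: Ck_coord.
  by apply: (IH ('D_(delta_mx ord0 i) f)); [exact: Df|exact: CkW].
move=> x Ux; have dfx := df _ (UU' _ Ux); have dgx := dg _ Ux.
rewrite deriveE; last exact: dfg.
rewrite diff_comp //= [X in 'd f _ X](_ : _ = \sum_i ('D_v g x) ord0 i *: delta_mx ord0 i).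
  rewrite linear_sum fct_sumE. apply: eq_bigr => i _.
  by rewrite /F (deriveE _ dfx) linearZ.
by rewrite -row_sum_delta (deriveE _ dgx).
Qed.

Lemma Cinfty_comp V n W (U : set 'rV[R]_n) (U' : set V) (f : 'rV[R]_n -> W)
    (g : V -> 'rV[R]_n) :
  open U' -> (forall x, U' x -> U (g x)) ->
  Cinfty U f -> Cinfty U' g -> Cinfty U' (f \o g).
Proof. by move=> oU' UU' hf hg k; exact: (Ck_comp oU' UU' (hf k) (hg k)). Qed.

Lemma Cinfty_eq V W (U : set V) (f g : V -> W) : open U ->
  (forall x, U x -> f x = g x) -> Cinfty U f -> Cinfty U g.
Proof. by move=> oU fg hf k; exact: (Ck_eq oU fg (hf k)). Qed.

Lemma Cinfty_sub V W (U U' : set V) (f : V -> W) :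
  U' `<=` U -> Cinfty U f -> Cinfty U' f.
Proof. by move=> s hf k; exact: (Ck_sub s (hf k)). Qed.

Lemma Cinfty_local V W (U : set V) (f : V -> W) :
  (forall x, U x -> exists U', [/\ open U', U' x & Cinfty U' f]) -> Cinfty U f.
Proof.
move=> h k; apply: Ck_local => x /h[U' [oU' U'x hU']].
by exists U' => //; exact: hU'.
Qed.

Lemma Cinfty_cst V W (U : set V) (c : W) : Cinfty U (fun=> c).
Proof. by move=> k; exact: Ck_cst. Qed.

Lemma Cinfty_id V (U : set V) : Cinfty U (fun x : V => x).
Proof.
case=> [|k] /=; first by move=> x _; exact: cvg_id.
split=> [x _|v].
  by apply: (@linear_differentiable R V V idfun) => ?; exact: cvg_id.
rewrite (_ : 'D_v _ = fun=> v); first exact: Ck_cst.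
by apply/funext => x; exact: derive_id.
Qed.

Lemma Cinfty_add V W (U : set V) (f g : V -> W) : open U ->
  Cinfty U f -> Cinfty U g -> Cinfty U (fun x => f x + g x).
Proof. by move=> oU hf hg k; exact: (CkD oU (hf k) (hg k)). Qed.

Lemma Cinfty_scale V W (U : set V) (r : V -> R) (f : V -> W) : open U ->
  Cinfty U r -> Cinfty U f -> Cinfty U (fun x => r x *: f x).
Proof. by move=> oU hr hf k; exact: (CkZ oU (hr k) (hf k)). Qed.

Lemma open_preimage_on V W (U : set V) (U' : set W) (g : V -> W) :
  open U -> open U' -> Cinfty U g -> open (U `&` g @^-1` U').
Proof.
move=> oU oU' /(_ 0%N) /= cg; rewrite openE => x [Ux U'gx].
apply: filterI; first by move: oU; rewrite openE; exact.
by apply: (cg x Ux); move: oU'; rewrite openE; exact.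
Qed.

End Smooth.

Section Diffeology.
Variable R : realType.

(* A parametrization U -> X of a domain U of R^n is represented by a total
   function on 'rV[R]_n; plot_local makes its values outside U irrelevant. *)
Record diffSpace := DiffSpace {
  dcarrier :> Type;
  plot : forall n, set 'rV[R]_n -> ('rV[R]_n -> dcarrier) -> Prop;
  plot_open : forall n (U : set 'rV[R]_n) p, plot U p -> open U;
  plot_cst : forall n (U : set 'rV[R]_n) x, open U -> plot U (fun=> x);
  plot_local : forall n (U : set 'rV[R]_n) p, open U ->
    (forall u, U u -> exists W q,
      [/\ W u, W `<=` U, plot W q & forall w, W w -> p w = q w]) ->
    plot U p;
  plot_comp : forall n m (U : set 'rV[R]_n) (W : set 'rV[R]_m) p g,
    plot U p -> open W -> Cinfty W g -> (forall w, W w -> U (g w)) ->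
    plot W (p \o g) }.

Arguments plot X [n] U p : rename.

Definition smooth (X Y : diffSpace) (f : X -> Y) : Prop :=
  forall n (U : set 'rV[R]_n) p, plot X U p -> plot Y U (f \o p).

Definition diffeomorphism (X Y : diffSpace) (f : X -> Y) : Prop :=
  smooth f /\ exists g : Y -> X, [/\ smooth g, cancel f g & cancel g f].

Lemma plot_sub (X : diffSpace) n (U W : set 'rV[R]_n) p :
  plot X U p -> open W -> W `<=` U -> plot X W p.
Proof. by move=> pp oW WU; apply: (plot_comp pp oW _ WU); exact: Cinfty_id. Qed.

Lemma plot_eq (X : diffSpace) n (U : set 'rV[R]_n) p q :
  plot X U p -> (forall u, U u -> p u = q u) -> plot X U q.
Proof.
move=> pp pq; apply: plot_local; first exact: plot_open pp.
by move=> u Uu; exists U, p; split=> // w /pq.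
Qed.

Section Std.
Variable V : normedModType R.
Definition std_plot n (U : set 'rV[R]_n) (p : 'rV[R]_n -> V) :=
  open U /\ Cinfty U p.
Lemma std_plot_open n (U : set 'rV[R]_n) p : std_plot U p -> open U.
Proof. by case. Qed.
Lemma std_plot_cst n (U : set 'rV[R]_n) x : open U -> std_plot U (fun=> x).
Proof. by move=> oU; split=> //; exact: Cinfty_cst. Qed.
Lemma std_plot_local n (U : set 'rV[R]_n) p : open U ->
  (forall u, U u -> exists W q,
    [/\ W u, W `<=` U, std_plot W q & forall w, W w -> p w = q w]) ->
  std_plot U p.
Proof.
move=> oU h; split=> //; apply: Cinfty_local => u /h[W [q [Wu _ [oW hq] pq]]].
by exists W; split=> //; apply: Cinfty_eq hq => // w /pq.
Qed.
Lemma std_plot_comp n m (U : set 'rV[R]_n) (W : set 'rV[R]_m) p g :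
  std_plot U p -> open W -> Cinfty W g -> (forall w, W w -> U (g w)) ->
  std_plot W (p \o g).
Proof. by move=> [oU hp] oW hg UW; split=> //; exact: Cinfty_comp hp hg. Qed.
Definition std : diffSpace :=
  DiffSpace std_plot_open std_plot_cst std_plot_local std_plot_comp.
End Std.

Section Sub.
Variables (X : diffSpace) (A : set X).
Definition sub_plot n (U : set 'rV[R]_n) (p : 'rV[R]_n -> {x : X | A x}) :=
  plot X U (fun u => sval (p u)).
Lemma sub_plot_open n (U : set 'rV[R]_n) p : sub_plot U p -> open U.
Proof. exact: plot_open. Qed.
Lemma sub_plot_cst n (U : set 'rV[R]_n) x : open U -> sub_plot U (fun=> x).
Proof. by move=> oU; exact: plot_cst. Qed.
Lemma sub_plot_local n (U : set 'rV[R]_n) p : open U ->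
  (forall u, U u -> exists W q,
    [/\ W u, W `<=` U, sub_plot W q & forall w, W w -> p w = q w]) ->
  sub_plot U p.
Proof.
move=> oU h; apply: plot_local => // u /h[W [q [Wu WU hq pq]]].
by exists W, (fun w => sval (q w)); split=> // w /pq ->.
Qed.
Lemma sub_plot_comp n m (U : set 'rV[R]_n) (W : set 'rV[R]_m) p g :
  sub_plot U p -> open W -> Cinfty W g -> (forall w, W w -> U (g w)) ->
  sub_plot W (p \o g).
Proof. exact: plot_comp. Qed.
Definition subD : diffSpace :=
  DiffSpace sub_plot_open sub_plot_cst sub_plot_local sub_plot_comp.

Lemma sub_inj (x y : subD) : sval x = sval y -> x = y.
Proof. by case: x y => x hx [y hy] /= xy; exact: eq_exist. Qed.

Lemma plot_sub_ex n (U : set 'rV[R]_n) p u : plot X U p -> U u ->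
  (forall w, U w -> A (p w)) ->
  exists2 p' : 'rV[R]_n -> subD, plot subD U p' &
    forall w, U w -> sval (p' w) = p w.
Proof.
move=> pp Uu h.
pose p' w : subD := if pselect (U w) is left Uw then exist _ (p w) (h w Uw)
                    else exist _ (p u) (h u Uu).
have p'p w : U w -> sval (p' w) = p w by rewrite /p'; case: pselect.
by exists p' => //; apply: (plot_eq pp) => w Uw; rewrite p'p.
Qed.
End Sub.

Section Prod.
Variables X Y : diffSpace.
Definition prod_plot n (U : set 'rV[R]_n) (p : 'rV[R]_n -> X * Y) :=
  plot X U (fun u => (p u).1) /\ plot Y U (fun u => (p u).2).
Lemma prod_plot_open n (U : set 'rV[R]_n) p : prod_plot U p -> open U.
Proof. by case=> /plot_open. Qed.
Lemma prod_plot_cst n (U : set 'rV[R]_n) x : open U -> prod_plot U (fun=> x).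
Proof. by move=> oU; split; exact: plot_cst. Qed.
Lemma prod_plot_local n (U : set 'rV[R]_n) p : open U ->
  (forall u, U u -> exists W q,
    [/\ W u, W `<=` U, prod_plot W q & forall w, W w -> p w = q w]) ->
  prod_plot U p.
Proof.
move=> oU h; split; apply: plot_local => // u /h[W [q [Wu WU [h1 h2] pq]]].
  by exists W, (fun w => (q w).1); split=> // w /pq ->.
by exists W, (fun w => (q w).2); split=> // w /pq ->.
Qed.
Lemma prod_plot_comp n m (U : set 'rV[R]_n) (W : set 'rV[R]_m) p g :
  prod_plot U p -> open W -> Cinfty W g -> (forall w, W w -> U (g w)) ->
  prod_plot W (p \o g).
Proof.
move=> [h1 h2] oW hg gU; split.
  exact: (plot_comp h1 oW hg gU).
exact: (plot_comp h2 oW hg gU).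
Qed.
Definition prodD : diffSpace :=
  DiffSpace prod_plot_open prod_plot_cst prod_plot_local prod_plot_comp.
End Prod.

Section Sum.
Variables X Y : diffSpace.
Definition sum_plot n (U : set 'rV[R]_n) (p : 'rV[R]_n -> X + Y) :=
  open U /\ forall u, U u -> exists W, [/\ W u, W `<=` U &
    (exists2 q, plot X W q & forall w, W w -> p w = inl (q w)) \/
    (exists2 q, plot Y W q & forall w, W w -> p w = inr (q w))].
Lemma sum_plot_open n (U : set 'rV[R]_n) p : sum_plot U p -> open U.
Proof. by case. Qed.
Lemma sum_plot_cst n (U : set 'rV[R]_n) x : open U -> sum_plot U (fun=> x).
Proof.
move=> oU; split=> // u Uu; exists U; split=> //.
by case: x => x; [left|right]; exists (fun=> x) => //; exact: plot_cst.
Qed.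
Lemma sum_plot_local n (U : set 'rV[R]_n) p : open U ->
  (forall u, U u -> exists W q,
    [/\ W u, W `<=` U, sum_plot W q & forall w, W w -> p w = q w]) ->
  sum_plot U p.
Proof.
move=> oU h; split=> // u /h[W [q [Wu WU [oW hq] pq]]].
have [W' [W'u W'W hq']] := hq _ Wu.
exists W'; split=> //; first exact: subset_trans WU.
by case: hq' => -[r hr qr]; [left|right]; exists r => // w W'w;
  rewrite (pq _ (W'W _ W'w)) qr.
Qed.
Lemma sum_plot_comp n m (U : set 'rV[R]_n) (W : set 'rV[R]_m) p g :
  sum_plot U p -> open W -> Cinfty W g -> (forall w, W w -> U (g w)) ->
  sum_plot W (p \o g).
Proof.
move=> [oU hp] oW hg gU; split=> // w Ww.
have [U' [U'g U'U hU']] := hp _ (gU _ Ww).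
have sg (Z : diffSpace) (r : 'rV[R]_n -> Z) : plot Z U' r -> plot Z (W `&` g @^-1` U') (r \o g).
  move=> hr; apply: (plot_comp hr); last by move=> x [].
    exact: open_preimage_on (plot_open hr) hg.
  by apply: Cinfty_sub hg; exact: subIsetl.
exists (W `&` g @^-1` U'); split; [by split | exact: subIsetl | ].
by case: hU' => -[r hr pr]; [left|right]; exists (r \o g);
  [exact: sg | move=> x [_ /= /pr] | exact: sg | move=> x [_ /= /pr]].
Qed.
Definition sumD : diffSpace :=
  DiffSpace sum_plot_open sum_plot_cst sum_plot_local sum_plot_comp.
End Sum.

Section Quot.
Variables (X : diffSpace) (r : X -> X -> Prop).
Let gen := Relation_Operators.clos_refl_sym_trans X r.
(* The quotient by the equivalence relation generated by r. *)
Definition quot : Type := {C : set X | exists x, C = [set y | gen x y]}.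
Definition qclass (x : X) : quot :=
  exist _ [set y | gen x y] (ex_intro _ x erefl).
Definition quot_plot n (U : set 'rV[R]_n) (p : 'rV[R]_n -> quot) :=
  open U /\ forall u, U u -> exists W q,
    [/\ W u, W `<=` U, plot X W q & forall w, W w -> p w = qclass (q w)].
Lemma quot_plot_open n (U : set 'rV[R]_n) p : quot_plot U p -> open U.
Proof. by case. Qed.

Lemma qclass_eqP (x y : X) : qclass x = qclass y <-> gen x y.
Proof.
split=> [/(congr1 sval)/= /seteqP[_ /(_ y)]|xy].
  by apply; exact: Relation_Operators.rst_refl.
apply: eq_exist; apply/seteqP; split=> z /= h.
  apply: Relation_Operators.rst_trans h; exact: Relation_Operators.rst_sym.
exact: Relation_Operators.rst_trans h.
Qed.

Definition qrepr (c : quot) : X := sval (cid (svalP c)).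
Lemma qreprK c : qclass (qrepr c) = c.
Proof.
rewrite /qrepr; case: cid => x /= e; case: c e => C hC /= e.
by apply: eq_exist; rewrite e.
Qed.

Lemma quot_plot_cst n (U : set 'rV[R]_n) x : open U -> quot_plot U (fun=> x).
Proof.
move=> oU; split=> // u Uu; exists U, (fun=> qrepr x); split=> //.
  exact: plot_cst.
by move=> w _; rewrite qreprK.
Qed.
Lemma quot_plot_local n (U : set 'rV[R]_n) p : open U ->
  (forall u, U u -> exists W q,
    [/\ W u, W `<=` U, quot_plot W q & forall w, W w -> p w = q w]) ->
  quot_plot U p.
Proof.
move=> oU h; split=> // u /h[W [q [Wu WU [oW hq] pq]]].
have [W' [q' [W'u W'W pq' hq']]] := hq _ Wu.
exists W', q'; split=> //; first exact: subset_trans WU.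
by move=> w W'w; rewrite pq ?hq' //; exact: W'W.
Qed.
Lemma quot_plot_comp n m (U : set 'rV[R]_n) (W : set 'rV[R]_m) p g :
  quot_plot U p -> open W -> Cinfty W g -> (forall w, W w -> U (g w)) ->
  quot_plot W (p \o g).
Proof.
move=> [oU hp] oW hg gU; split=> // w Ww.
have [U' [q [U'g U'U pq hU']]] := hp _ (gU _ Ww).
exists (W `&` g @^-1` U'), (q \o g); split; [by split | exact: subIsetl | | ].
  apply: (plot_comp pq); last by move=> x [].
    exact: open_preimage_on (plot_open pq) hg.
  by apply: Cinfty_sub hg; exact: subIsetl.
by move=> x [_ /= /hU'].
Qed.
Definition quotD : diffSpace :=
  DiffSpace quot_plot_open quot_plot_cst quot_plot_local quot_plot_comp.
End Quot.

(* The fibre over x is the set of v such that pb_proj v = x, and vzero x is its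
   origin.  Only the restriction of vadd to V x_X V is meaningful: off it,
   vadd v w is a junk value, chosen by proj_add to lie in the fibre of v (any
   fibrewise addition extends in this way, e.g. by v). *)
Record pseudo_bundle := PseudoBundle {
  pb_total : diffSpace;
  pb_base : diffSpace;
  pb_proj : pb_total -> pb_base;
  vadd : pb_total -> pb_total -> pb_total;
  vscale : R -> pb_total -> pb_total;
  vzero : pb_base -> pb_total;
  proj_add : forall v w, pb_proj (vadd v w) = pb_proj v;
  proj_scale : forall a v, pb_proj (vscale a v) = pb_proj v;
  proj_zero : forall x, pb_proj (vzero x) = x;
  vaddA : forall u v w, pb_proj u = pb_proj v -> pb_proj v = pb_proj w ->
    vadd u (vadd v w) = vadd (vadd u v) w;
  vaddC : forall v w, pb_proj v = pb_proj w -> vadd v w = vadd w v;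
  vadd0 : forall v, vadd v (vzero (pb_proj v)) = v;
  vaddN : forall v, vadd v (vscale (- 1) v) = vzero (pb_proj v);
  vscale1 : forall v, vscale 1 v = v;
  vscaleA : forall a b v, vscale a (vscale b v) = vscale (a * b) v;
  vscaleDl : forall a b v, vscale (a + b) v = vadd (vscale a v) (vscale b v);
  vscaleDr : forall a v w, pb_proj v = pb_proj w ->
    vscale a (vadd v w) = vadd (vscale a v) (vscale a w);
  smooth_proj : smooth pb_proj;
  smooth_add : @smooth
    (@subD (prodD pb_total pb_total) [set z | pb_proj z.1 = pb_proj z.2])
    pb_total (fun z => vadd (sval z).1 (sval z).2);
  smooth_scale : @smooth (prodD (std R) pb_total) pb_total (fun z => vscale z.1 z.2);
  smooth_zero : smooth vzero }.

Definition finite_dim_fibres (B : pseudo_bundle) : Prop :=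
  forall x : pb_base B, exists n (e : 'I_n -> pb_total B),
    (forall i, pb_proj (e i) = x) /\
    forall v, pb_proj v = x -> exists c : 'I_n -> R,
      v = \big[@vadd B/vzero x]_(i < n) vscale (c i) (e i).

Definition fibrewise_linear (B B' : pseudo_bundle) (F : pb_total B -> pb_total B') :=
  (forall v w, pb_proj v = pb_proj w -> F (vadd v w) = vadd (F v) (F w)) /\
  (forall a v, F (vscale a v) = vscale a (F v)).

Definition pb_diffeo (B B' : pseudo_bundle) (F : pb_total B -> pb_total B')
    (phi : pb_base B -> pb_base B') : Prop :=
  [/\ diffeomorphism F, diffeomorphism phi,
      forall v, pb_proj (F v) = phi (pb_proj v) & fibrewise_linear F].

Definition pb_diffeomorphic (B B' : pseudo_bundle) : Prop :=
  exists F phi, @pb_diffeo B B' F phi.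

Lemma plot_add (B : pseudo_bundle) n (U : set 'rV[R]_n) p q :
  plot (pb_total B) U p -> plot (pb_total B) U q ->
  (forall u, U u -> pb_proj (p u) = pb_proj (q u)) ->
  plot (pb_total B) U (fun u => vadd (p u) (q u)).
Proof.
move=> hp hq pq; apply: plot_local; first exact: plot_open hp.
move=> u Uu.
have [] := @plot_sub_ex (prodD (pb_total B) (pb_total B)) [set z | pb_proj z.1 = pb_proj z.2]
  n U (fun u => (p u, q u)) u _ Uu pq; first by split.
move=> p' hp' e; exists U, (fun w => vadd (sval (p' w)).1 (sval (p' w)).2).
split=> //; first exact: (smooth_add hp').
by move=> w /e ->.
Qed.

Lemma plot_scale (B : pseudo_bundle) n (U : set 'rV[R]_n) (r : 'rV[R]_n -> R) p :
  Cinfty U r -> plot (pb_total B) U p ->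
  plot (pb_total B) U (fun u => vscale (r u) (p u)).
Proof.
move=> hr hp; apply: (@smooth_scale B n U (fun u => (r u, p u))).
by split=> //; split=> //; exact: plot_open hp.
Qed.

Section Restrict.
Variables (B : pseudo_bundle) (A : set (pb_base B)).
Let T := @subD (pb_total B) (@pb_proj B @^-1` A).
Let X := subD A.
Definition res_proj (v : T) : X := exist _ (pb_proj (sval v)) (svalP v).
Definition res_add (v w : T) : T := exist _ (vadd (sval v) (sval w))
  (eq_ind_r A (svalP v) (proj_add (sval v) (sval w))).
Definition res_scale (a : R) (v : T) : T := exist _ (vscale a (sval v))
  (eq_ind_r A (svalP v) (proj_scale a (sval v))).
Definition res_zero (x : X) : T := exist _ (vzero (sval x))
  (eq_ind_r A (svalP x) (proj_zero (sval x))).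

Lemma res_fibre (v w : T) : res_proj v = res_proj w ->
  pb_proj (sval v) = pb_proj (sval w).
Proof. by move=> /(congr1 sval). Qed.

Definition restrict_bundle : pseudo_bundle.
Proof.
refine (@PseudoBundle T X res_proj res_add res_scale res_zero
  _ _ _ _ _ _ _ _ _ _ _ _ _ _ _).
- by move=> v w; apply: sub_inj; exact: proj_add.
- by move=> a v; apply: sub_inj; exact: proj_scale.
- by move=> x; apply: sub_inj; exact: proj_zero.
- by move=> u v w /res_fibre uv /res_fibre vw; apply: sub_inj; exact: vaddA.
- by move=> v w /res_fibre vw; apply: sub_inj; exact: vaddC.
- by move=> v; apply: sub_inj; exact: vadd0.
- by move=> v; apply: sub_inj; exact: vaddN.
- by move=> v; apply: sub_inj; exact: vscale1.
- by move=> a b v; apply: sub_inj; exact: vscaleA.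
- by move=> a b v; apply: sub_inj; exact: vscaleDl.
- by move=> a v w /res_fibre vw; apply: sub_inj; exact: vscaleDr.
- by move=> n U p hp; exact: (smooth_proj hp).
- move=> n U p [h1 h2]; apply: (plot_add h1 h2) => u Uu.
  exact: res_fibre (svalP (p u)).
- by move=> n U p [[_ h1] h2]; exact: plot_scale.
- by move=> n U p hp; exact: (smooth_zero hp).
Defined.
End Restrict.

Section Dual.
Variable B : pseudo_bundle.

(* A smooth linear form on the fibre over dpt, extended by 0 to the whole total
   space; this extension makes equality of dual vectors extensional. *)
Record dual_vec := DualVec {
  dpt : pb_base B;
  dfun : pb_total B -> R;
  dfun_supp : forall v, pb_proj v <> dpt -> dfun v = 0;
  dfunD : forall v w, pb_proj v = dpt -> pb_proj w = dpt ->
    dfun (vadd v w) = dfun v + dfun w;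
  dfunZ : forall a v, pb_proj v = dpt -> dfun (vscale a v) = a * dfun v;
  dfun_smooth :
    @smooth (@subD (pb_total B) [set v | pb_proj v = dpt]) (std R)
      (fun v => dfun (sval v)) }.

Lemma dual_vec_eq (a b : dual_vec) :
  dpt a = dpt b -> (forall v, pb_proj v = dpt a -> dfun a v = dfun b v) -> a = b.
Proof.
case: a b => x f s1 l1 z1 h1 [y g s2 l2 z2 h2] /= e; subst y => fg.
have e : f = g.
  apply/funext => v; have [e|ne] := pselect (pb_proj v = x); first exact: fg.
  by rewrite s1 // s2.
subst g; by congr DualVec; exact: Prop_irrelevance.
Qed.

Definition dual_plot n (U : set 'rV[R]_n) (p : 'rV[R]_n -> dual_vec) :=
  plot (pb_base B) U (dpt \o p) /\
  forall m (U' : set 'rV[R]_m) (q : 'rV[R]_m -> pb_total B), plot (pb_total B) U' q ->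
    @smooth (@subD (prodD (std 'rV[R]_n) (std 'rV[R]_m))
               [set z | [/\ U z.1, U' z.2 & dpt (p z.1) = pb_proj (q z.2)]])
      (std R) (fun z => dfun (p (sval z).1) (q (sval z).2)).

Lemma dual_plotP n (U : set 'rV[R]_n) (p : 'rV[R]_n -> dual_vec) :
  dual_plot U p <-> plot (pb_base B) U (dpt \o p) /\
  forall k (W : set 'rV[R]_k) (a : 'rV[R]_k -> 'rV[R]_n) (v : 'rV[R]_k -> pb_total B),
    open W -> Cinfty W a -> (forall w, W w -> U (a w)) ->
    plot (pb_total B) W v -> (forall w, W w -> dpt (p (a w)) = pb_proj (v w)) ->
    Cinfty W (fun w => dfun (p (a w)) (v w)).
Proof.
split=> -[h1 h2]; split=> //.
  move=> k W a v oW ha aU hv e; apply: Cinfty_local => w0 Ww0.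
  have [] := @plot_sub_ex (prodD (std 'rV[R]_n) (std 'rV[R]_k))
    [set z | [/\ U z.1, W z.2 & dpt (p z.1) = pb_proj (v z.2)]] k W
    (fun w => (a w, w)) w0 _ Ww0.
  - by split; split=> //; exact: Cinfty_id.
  - by move=> w Ww; split=> //=; [exact: aU|exact: e].
  move=> c hc ec; exists W; split=> //.
  have [_ /=] := h2 k W v hv _ _ _ hc.
  by apply: Cinfty_eq => // w Ww /=; rewrite ec.
move=> m U' q hq k W c [[oW h3] [_ h4]]; split=> //.
have hc w : [/\ U (sval (c w)).1, U' (sval (c w)).2 &
    dpt (p (sval (c w)).1) = pb_proj (q (sval (c w)).2)] := svalP (c w).
apply: h2 => //.
- by move=> w _; case: (hc w).
- by apply: (plot_comp hq oW h4) => w _; case: (hc w).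
- by move=> w _; case: (hc w).
Qed.

Lemma dual_plot_open n (U : set 'rV[R]_n) p : dual_plot U p -> open U.
Proof. by case=> /plot_open. Qed.
Lemma dual_plot_cst n (U : set 'rV[R]_n) x : open U -> dual_plot U (fun=> x).
Proof.
move=> oU; apply/dual_plotP; split; first exact: plot_cst.
move=> k W a v oW _ _ hv e; apply: Cinfty_local => w0 Ww0.
have [c hc ec] := @plot_sub_ex (pb_total B) [set v | pb_proj v = dpt x] k W v w0 hv Ww0
  (fun w Ww => esym (e w Ww)).
exists W; split=> //; have [_] := dfun_smooth hc.
by apply: Cinfty_eq => // w Ww /=; rewrite ec.
Qed.
Lemma dual_plot_local n (U : set 'rV[R]_n) p : open U ->
  (forall u, U u -> exists W q,
    [/\ W u, W `<=` U, dual_plot W q & forall w, W w -> p w = q w]) ->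
  dual_plot U p.
Proof.
move=> oU h; apply/dual_plotP; split.
  apply: plot_local => // u /h[W [q [Wu WU [hq _] pq]]].
  by exists W, (dpt \o q); split=> // w Ww /=; rewrite pq.
move=> k W a v oW ha aU hv e; apply: Cinfty_local => w0 Ww0.
have [U' [q [U'u U'U /[dup] /dual_plot_open oU' /dual_plotP[_ hq] pq]]] :=
  h _ (aU _ Ww0).
have oW' := open_preimage_on oW oU' ha.
have sW : W `&` a @^-1` U' `<=` W by exact: subIsetl.
exists (W `&` a @^-1` U'); split=> //.
apply: (@Cinfty_eq _ _ _ _ (fun w => dfun (q (a w)) (v w))) => //.
  by move=> w [_ /= U'a]; rewrite pq.
apply: hq => //.
- exact: Cinfty_sub ha.
- by move=> w [].
- exact: plot_sub hv _ _.
- by move=> w [Ww /= U'a]; rewrite -pq // e.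
Qed.
Lemma dual_plot_comp n m (U : set 'rV[R]_n) (W : set 'rV[R]_m) p g :
  dual_plot U p -> open W -> Cinfty W g -> (forall w, W w -> U (g w)) ->
  dual_plot W (p \o g).
Proof.
move=> /dual_plotP[h1 h2] oW hg gU; apply/dual_plotP; split.
  exact: (plot_comp h1 oW hg gU).
move=> k U' a v oU' ha aW hv e; apply: (h2 k U' (g \o a)) => //.
- exact: Cinfty_comp hg ha.
- by move=> w /aW /gU.
Qed.
Definition dualD : diffSpace :=
  DiffSpace dual_plot_open dual_plot_cst dual_plot_local dual_plot_comp.

Lemma dual_zero_smooth (x : pb_base B) :
  @smooth (@subD (pb_total B) [set v | pb_proj v = x]) (std R) (fun v => 0).
Proof.
by move=> n U p hp; split; [exact: plot_open hp|exact: Cinfty_cst].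
Qed.
Definition dual_zero (x : pb_base B) : dual_vec.
Proof.
refine (@DualVec x (fun=> 0) _ _ _ (@dual_zero_smooth x)) => //.
- by move=> v w _ _; rewrite addr0.
- by move=> a v _; rewrite mulr0.
Defined.

Lemma dual_scale_smooth (a : R) (l : dual_vec) :
  @smooth (@subD (pb_total B) [set v | pb_proj v = dpt l]) (std R)
    (fun v => a * dfun l (sval v)).
Proof.
move=> n U p hp; have oU := plot_open hp; split=> //.
apply: (@Cinfty_scale _ _ R^o) => //; first exact: Cinfty_cst.
by have [] := dfun_smooth hp.
Qed.
Definition dual_scale (a : R) (l : dual_vec) : dual_vec.
Proof.
refine (@DualVec (dpt l) (fun v => a * dfun l v) _ _ _ (@dual_scale_smooth a l)).
- by move=> v /dfun_supp ->; rewrite mulr0.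
- by move=> v w hv hw; rewrite dfunD // mulrDr.
- by move=> b v hv; rewrite dfunZ // !mulrA (mulrC a).
Defined.

Lemma dual_add_smooth (l l' : dual_vec) : dpt l = dpt l' ->
  @smooth (@subD (pb_total B) [set v | pb_proj v = dpt l]) (std R)
    (fun v => dfun l (sval v) + dfun l' (sval v)).
Proof.
move=> e n U p hp; have oU := plot_open hp; split=> //.
apply: Cinfty_add => //; first by have [] := dfun_smooth hp.
have h' := @dfun_smooth l'; rewrite -e in h'.
by have [] := h' _ _ _ hp.
Qed.
Definition dual_add_eq (l l' : dual_vec) (e : dpt l = dpt l') : dual_vec.
Proof.
refine (@DualVec (dpt l) (fun v => dfun l v + dfun l' v) _ _ _ (dual_add_smooth e)).
- by move=> v nv; rewrite !dfun_supp ?addr0 -?e.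
- by move=> v w hv hw; rewrite !dfunD -?e // addrACA.
- by move=> b v hv; rewrite !dfunZ -?e // mulrDr.
Defined.
(* Outside pairs lying in the same fibre the value is junk. *)
Definition dual_add (l l' : dual_vec) : dual_vec :=
  if pselect (dpt l = dpt l') is left e then dual_add_eq e else l.

Lemma dpt_add l l' : dpt (dual_add l l') = dpt l.
Proof. by rewrite /dual_add; case: pselect. Qed.
Lemma dfun_add l l' v : dpt l = dpt l' ->
  dfun (dual_add l l') v = dfun l v + dfun l' v.
Proof. by rewrite /dual_add; case: pselect. Qed.

Lemma dual_smooth_add :
  @smooth (@subD (prodD dualD dualD) [set z | dpt z.1 = dpt z.2]) dualD
    (fun z => dual_add (sval z).1 (sval z).2).
Proof.
move=> n U p [/dual_plotP[h1 h1'] /dual_plotP[h2 h2']].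
have e w : dpt (sval (p w)).1 = dpt (sval (p w)).2 := svalP (p w).
apply/dual_plotP; split.
  by apply: plot_eq h1 _ => u _ /=; rewrite dpt_add.
move=> k W a v oW ha aU hv ev.
apply: (@Cinfty_eq _ _ _ _
  (fun w => dfun (sval (p (a w))).1 (v w) + dfun (sval (p (a w))).2 (v w))) => //.
  by move=> w _ /=; rewrite dfun_add.
apply: Cinfty_add => //.
  by apply: h1' => // w Ww; rewrite -ev //= dpt_add.
by apply: h2' => // w Ww; rewrite -ev //= dpt_add e.
Qed.
Lemma dual_smooth_scale :
  @smooth (prodD (std R) dualD) dualD (fun z => dual_scale z.1 z.2).
Proof.
move=> n U p [[oU h1] /dual_plotP[h2 h2']].
apply/dual_plotP; split=> //.
move=> k W a v oW ha aU hv ev.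
apply: (@Cinfty_scale _ _ R^o) => //; first exact: Cinfty_comp h1 ha.
exact: h2'.
Qed.
Lemma dual_smooth_zero : @smooth (pb_base B) dualD dual_zero.
Proof.
move=> n U p hp; apply/dual_plotP; split=> //.
by move=> *; exact: Cinfty_cst.
Qed.

Definition dual_bundle : pseudo_bundle.
Proof.
refine (@PseudoBundle dualD (pb_base B) dpt dual_add dual_scale dual_zero
  _ _ _ _ _ _ _ _ _ _ _ _ _ _ _) => //.
- exact: dpt_add.
- move=> u v w uv vw; apply: dual_vec_eq; first by rewrite !dpt_add.
  by move=> x _; rewrite !dfun_add ?dpt_add // ?addrA // uv.
- move=> v w vw; apply: dual_vec_eq; first by rewrite !dpt_add.
  by move=> x _; rewrite !dfun_add // addrC.
- move=> v; apply: dual_vec_eq; first by rewrite dpt_add.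
  by move=> x _; rewrite dfun_add //= addr0.
- move=> v; apply: dual_vec_eq; first by rewrite dpt_add.
  by move=> x _; rewrite dfun_add //= mulN1r subrr.
- by move=> v; apply: dual_vec_eq => // x _ /=; rewrite mul1r.
- by move=> a b v; apply: dual_vec_eq => // x _ /=; rewrite mulrA.
- move=> a b v; apply: dual_vec_eq; first by rewrite dpt_add.
  by move=> x _; rewrite dfun_add //= mulrDl.
- move=> a v w vw; apply: dual_vec_eq; first by rewrite /= !dpt_add.
  by move=> x _; rewrite dfun_add //= dfun_add // mulrDr.
- by move=> n U p [].
- exact: dual_smooth_add.
- exact: dual_smooth_scale.
- exact: dual_smooth_zero.
Defined.
End Dual.

Section GlueSpace.
Variables (X1 X2 : diffSpace) (Y : set X1) (f : subD Y -> X2).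

Definition glue_rel (a b : X1 + X2) : Prop :=
  exists y : subD Y, a = inl (sval y) /\ b = inr (f y).
Definition glueD : diffSpace := @quotD (sumD X1 X2) glue_rel.
Definition gclass (a : X1 + X2) : glueD := @qclass (sumD X1 X2) glue_rel a.

(* The canonical representative of the class of a: a point of X2 if there is
   one, and otherwise a point of X1 outside Y. *)
Definition gnorm (a : X1 + X2) : X1 + X2 :=
  match a with
  | inl x => if pselect (Y x) is left h then inr (f (exist _ x h)) else inl x
  | inr x => inr x
  end.
Definition grepr (c : glueD) : X1 + X2 := gnorm (qrepr c).

Lemma gnorm_in (y : subD Y) : gnorm (inl (sval y)) = inr (f y).
Proof.
rewrite /gnorm; case: pselect => [h|/(_ (svalP y)) //].
by congr (inr (f _)); exact: sub_inj.
Qed.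

Lemma gnorm_out x : ~ Y x -> gnorm (inl x) = inl x.
Proof. by rewrite /gnorm; case: pselect. Qed.

Lemma gclass_in (y : subD Y) : gclass (inl (sval y)) = gclass (inr (f y)).
Proof.
by apply/qclass_eqP; apply: Relation_Operators.rst_step; exists y.
Qed.

Lemma gclass_norm a : gclass (gnorm a) = gclass a.
Proof.
case: a => // x /=; case: pselect => // h.
by rewrite -gclass_in.
Qed.

Lemma gclassP a b : gclass a = gclass b <-> gnorm a = gnorm b.
Proof.
split=> [/qclass_eqP|e]; last by rewrite -gclass_norm e gclass_norm.
elim=> // [{}a {}b [y [-> ->]]|x y z _ -> _ ->] //.
by rewrite gnorm_in.
Qed.

Lemma greprK c : gclass (grepr c) = c.
Proof. by rewrite gclass_norm; exact: qreprK. Qed.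

Lemma grepr_class a : grepr (gclass a) = gnorm a.
Proof. by apply/gclassP; exact: qreprK. Qed.

Lemma gnorm_idem a : gnorm (gnorm a) = gnorm a.
Proof. by apply/gclassP; exact: gclass_norm. Qed.

Lemma grepr_out c x : grepr c = inl x -> ~ Y x.
Proof.
move=> e Yx; have := gnorm_idem (qrepr c); rewrite -/(grepr c) e.
by rewrite (gnorm_in (exist _ x Yx)).
Qed.

Lemma gclass_inl_inj x y : injective f ->
  gclass (inl x) = gclass (inl y) -> x = y.
Proof.
move=> fi /gclassP /=; case: pselect => h; case: pselect => h' // -[] //.
by move=> /fi /(congr1 sval).
Qed.
Lemma gclass_inr_inj x y : gclass (inr x) = gclass (inr y) -> x = y.
Proof. by move=> /gclassP []. Qed.
Lemma gclass_mix x y : gclass (inl x) = gclass (inr y) ->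
  exists h : Y x, f (exist _ x h) = y.
Proof. by move=> /gclassP /=; case: pselect => // h -[]; exists h. Qed.

Lemma glue_plot n (U : set 'rV[R]_n) (p : 'rV[R]_n -> glueD) u :
  plot glueD U p -> U u -> exists W, [/\ W u, W `<=` U &
    (exists2 q, plot X1 W q & forall w, W w -> p w = gclass (inl (q w))) \/
    (exists2 q, plot X2 W q & forall w, W w -> p w = gclass (inr (q w)))].
Proof.
move=> [oU hp] /hp[W [q [Wu WU [oW hq] pq]]].
have [W' [W'u W'W h]] := hq _ Wu.
exists W'; split=> //; first exact: subset_trans WU.
by case: h => -[r hr qr]; [left|right]; exists r => // w W'w;
  rewrite pq ?qr //; exact: W'W.
Qed.

Lemma plot_gclass_inl n (U : set 'rV[R]_n) p :
  plot X1 U p -> plot glueD U (fun u => gclass (inl (p u))).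
Proof.
move=> hp; have oU := plot_open hp; split=> // u Uu.
exists U, (fun u => inl (p u)); split=> //; split=> // v Uv.
by exists U; split=> //; left; exists p.
Qed.
Lemma plot_gclass_inr n (U : set 'rV[R]_n) p :
  plot X2 U p -> plot glueD U (fun u => gclass (inr (p u))).
Proof.
move=> hp; have oU := plot_open hp; split=> // u Uu.
exists U, (fun u => inr (p u)); split=> //; split=> // v Uv.
by exists U; split=> //; right; exists p.
Qed.
End GlueSpace.

(* f~ takes its values in pi_2^-1(f(Y)) by the second condition. *)
Definition smooth_linear_lift (B1 B2 : pseudo_bundle) (Y : set (pb_base B1))
    (f : subD Y -> pb_base B2)
    (ft : pb_total (restrict_bundle Y) -> pb_total B2) : Prop :=
  [/\ smooth ft, forall v, pb_proj (ft v) = f (pb_proj v) &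
      @fibrewise_linear (restrict_bundle Y) B2 ft].

Section GlueBundle.
Variables (B1 B2 : pseudo_bundle) (Y : set (pb_base B1)).
Variables (f : subD Y -> pb_base B2) (ft : pb_total (restrict_bundle Y) -> pb_total B2).
Hypothesis f_inj : injective f.
Hypothesis ft_lift : smooth_linear_lift f ft.

Let X := glueD f.
Let V := @glueD (pb_total B1) (pb_total B2) _ ft.
Let cl (a : pb_total B1 + pb_total B2) : V := gclass ft a.

Definition sum_proj (a : pb_total B1 + pb_total B2) : pb_base B1 + pb_base B2 :=
  match a with inl v => inl (pb_proj v) | inr v => inr (pb_proj v) end.
Definition glue_proj (c : V) : X := gclass f (sum_proj (grepr c)).

(* On canonical representatives: the fibre over a point of X1 outside Y gets the
   structure of B1 and the other fibres that of B2.  The last case of glue_add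
   only concerns points of different fibres. *)
Definition glue_add (c d : V) : V :=
  match grepr c, grepr d with
  | inl v, inl w => cl (inl (vadd v w))
  | inr v, inr w => cl (inr (vadd v w))
  | _, _ => c
  end.
Definition glue_scale (a : R) (c : V) : V :=
  match grepr c with
  | inl v => cl (inl (vscale a v))
  | inr v => cl (inr (vscale a v))
  end.
Definition glue_zero (x : X) : V :=
  match grepr x with
  | inl y => cl (inl (vzero y))
  | inr y => cl (inr (vzero y))
  end.

Lemma sum_proj_norm a : sum_proj (gnorm ft a) = gnorm f (sum_proj a).
Proof.
have [_ h _] := ft_lift; case: a => // v; rewrite [in RHS]/sum_proj.
have [Yv|nYv] := pselect (Y (pb_proj v)); last first.
  by rewrite [in RHS]gnorm_out // gnorm_out.
pose v' : pb_total (restrict_bundle Y) := exist _ v Yv.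
by rewrite [gnorm ft _](gnorm_in ft v') [RHS](gnorm_in f (pb_proj v')) /= h.
Qed.
Lemma glue_proj_class a : glue_proj (cl a) = gclass f (sum_proj a).
Proof. by rewrite /glue_proj /cl grepr_class sum_proj_norm gclass_norm. Qed.
Lemma grepr_proj c : grepr (glue_proj c) = sum_proj (grepr c).
Proof.
by rewrite /glue_proj grepr_class -sum_proj_norm /grepr gnorm_idem.
Qed.

Lemma ft_zero (y : subD Y) : ft (@vzero (restrict_bundle Y) y) = vzero (f y).
Proof.
have [_ hp [hD hZ]] := ft_lift.
have pz : pb_proj (@vzero (restrict_bundle Y) y) = y by exact: proj_zero.
rewrite -{1}pz -vaddN hD ?hZ ?proj_scale //.
by rewrite vaddN hp pz.
Qed.

Lemma cl_in (v : pb_total (restrict_bundle Y)) : cl (inl (sval v)) = cl (inr (ft v)).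
Proof. exact: gclass_in. Qed.
Lemma cl_addr v w : glue_add (cl (inr v)) (cl (inr w)) = cl (inr (vadd v w)).
Proof. by rewrite /glue_add /cl !grepr_class. Qed.
Lemma cl_addl v w : pb_proj v = pb_proj w ->
  glue_add (cl (inl v)) (cl (inl w)) = cl (inl (vadd v w)).
Proof.
move=> vw; have [_ hp [hD _]] := ft_lift.
have [Yv|nYv] := pselect (Y (pb_proj v)); last first.
  rewrite /glue_add /cl !grepr_class !gnorm_out //.
  by rewrite /preimage /= -vw.
have Yw : Y (pb_proj w) by rewrite -vw.
pose v' : pb_total (restrict_bundle Y) := exist _ v Yv.
pose w' : pb_total (restrict_bundle Y) := exist _ w Yw.
rewrite [cl (inl v)](cl_in v') [cl (inl w)](cl_in w') cl_addr -hD; last exact: sub_inj.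
by rewrite -cl_in.
Qed.
Lemma cl_scalel a v : glue_scale a (cl (inl v)) = cl (inl (vscale a v)).
Proof.
have [_ hp [_ hZ]] := ft_lift.
have [Yv|nYv] := pselect (Y (pb_proj v)); last first.
  by rewrite /glue_scale /cl grepr_class gnorm_out.
pose v' : pb_total (restrict_bundle Y) := exist _ v Yv.
rewrite [cl (inl v)](cl_in v') /glue_scale {1}/cl grepr_class /=.
by rewrite -hZ -cl_in.
Qed.
Lemma cl_scaler a v : glue_scale a (cl (inr v)) = cl (inr (vscale a v)).
Proof. by rewrite /glue_scale /cl grepr_class. Qed.
Lemma cl_zerol x : glue_zero (gclass f (inl x)) = cl (inl (vzero x)).
Proof.
have [Yx|nYx] := pselect (Y x); last first.
  by rewrite /glue_zero grepr_class gnorm_out.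
pose y : subD Y := exist _ x Yx.
rewrite /glue_zero grepr_class [gnorm _ _](gnorm_in f y).
by rewrite -ft_zero -cl_in.
Qed.
Lemma cl_zeror x : glue_zero (gclass f (inr x)) = cl (inr (vzero x)).
Proof. by rewrite /glue_zero grepr_class. Qed.

Lemma glue_ind (P : V -> Prop) : (forall a, P (cl a)) -> forall c, P c.
Proof. by move=> h c; rewrite -(greprK c); exact: h. Qed.

Lemma glue_fibre2 c d : glue_proj c = glue_proj d ->
  (exists v w, [/\ c = cl (inl v), d = cl (inl w) & pb_proj v = pb_proj w]) \/
  (exists v w, [/\ c = cl (inr v), d = cl (inr w) & pb_proj v = pb_proj w]).
Proof.
move=> /(congr1 (@grepr _ _ _ _)); rewrite !grepr_proj.
have := greprK c; have := greprK d.
case: (grepr c) => v; case: (grepr d) => w <- <- //= -[] e; [left|right];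
  by exists v, w.
Qed.
Lemma glue_fibre3 b c d : glue_proj b = glue_proj c -> glue_proj c = glue_proj d ->
  (exists u v w, [/\ b = cl (inl u), c = cl (inl v), d = cl (inl w) &
     pb_proj u = pb_proj v /\ pb_proj v = pb_proj w]) \/
  (exists u v w, [/\ b = cl (inr u), c = cl (inr v), d = cl (inr w) &
     pb_proj u = pb_proj v /\ pb_proj v = pb_proj w]).
Proof.
move=> /(congr1 (@grepr _ _ _ _)) + /(congr1 (@grepr _ _ _ _)); rewrite !grepr_proj.
have := greprK b; have := greprK c; have := greprK d.
case: (grepr b) => u; case: (grepr c) => v; case: (grepr d) => w <- <- <- //= -[] e -[] e';
  [left|right]; by exists u, v, w.
Qed.

Lemma glue_smooth_proj : smooth glue_proj.
Proof.
move=> n U p hp; apply: plot_local; first exact: plot_open hp.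
move=> u Uu; have [W [Wu WU [] [q hq pq]]] := glue_plot hp Uu.
  exists W, (fun w => gclass f (inl (pb_proj (q w)))); split=> //.
    by apply: plot_gclass_inl; exact: (smooth_proj hq).
  by move=> w Ww /=; rewrite pq // glue_proj_class.
exists W, (fun w => gclass f (inr (pb_proj (q w)))); split=> //.
  by apply: plot_gclass_inr; exact: (smooth_proj hq).
by move=> w Ww /=; rewrite pq // glue_proj_class.
Qed.
Lemma glue_smooth_add :
  @smooth (@subD (prodD V V) [set z | glue_proj z.1 = glue_proj z.2]) V
    (fun z => glue_add (sval z).1 (sval z).2).
Proof.
move=> n U p [h1 h2]; apply: plot_local; first exact: plot_open h1.
have e w : glue_proj (sval (p w)).1 = glue_proj (sval (p w)).2 := svalP (p w).
move=> u Uu.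
have [W1 [W1u W1U H1]] := glue_plot h1 Uu.
have [W2 [W2u W2U H2]] := glue_plot h2 Uu.
have res (Z : diffSpace) (W W' : set 'rV[R]_n) (q : _ -> Z) :
  plot Z W q -> open W' -> plot Z (W `&` W') q.
  move=> hq oW'; apply: (plot_sub hq); last exact: subIsetl.
  by apply: openI => //; exact: plot_open hq.
have mix (W : set 'rV[R]_n) q1 q2 : W u -> plot (pb_total B1) W q1 -> plot (pb_total B2) W q2 ->
    (forall w, W w -> glue_proj (cl (inl (q1 w))) = glue_proj (cl (inr (q2 w)))) ->
    exists q1', [/\ plot (pb_total B2) W q1',
      forall w, W w -> cl (inl (q1 w)) = cl (inr (q1' w)) &
      forall w, W w -> pb_proj (q1' w) = pb_proj (q2 w)].
  move=> Wu hq1 hq2 e12.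
  have Yq w : W w -> Y (pb_proj (q1 w)).
    by move=> /e12; rewrite !glue_proj_class /= => /gclass_mix[].
  have [c hc ec] := @plot_sub_ex _ (@pb_proj B1 @^-1` Y) _ _ _ _ hq1 Wu Yq.
  have [sft hft _] := ft_lift.
  exists (ft \o c); split=> [|w Ww|w Ww]; first exact: (sft _ _ _ hc).
    by rewrite -ec //= /cl gclass_in.
  rewrite /= hft; have := e12 _ Ww; rewrite !glue_proj_class /= => /gclass_mix[h <-].
  by congr f; apply: sub_inj; rewrite /= ec.
case: H1 => -[q1 hq1 pq1]; case: H2 => -[q2 hq2 pq2];
  have oW1 := plot_open hq1; have oW2 := plot_open hq2;
  have hq1' := res _ _ _ _ hq1 oW2;
  have := res _ _ _ _ hq2 oW1; rewrite setIC => hq2';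
  have Wu : (W1 `&` W2) u by split.
+ have pr w : (W1 `&` W2) w -> pb_proj (q1 w) = pb_proj (q2 w).
    move=> [w1 w2]; have := e w; rewrite pq1 // pq2 // !glue_proj_class.
    exact: gclass_inl_inj.
  exists (W1 `&` W2), (fun w => cl (inl (vadd (q1 w) (q2 w)))); split=> //.
  * by move=> w [/W1U].
  * by apply: plot_gclass_inl; exact: plot_add.
  * by move=> w /[dup] Ww [w1 w2] /=; rewrite pq1 // pq2 // cl_addl //; exact: pr.
+ have [|q1' [hq eq pr]] := mix _ _ _ Wu hq1' hq2'.
    by move=> w [w1 w2]; have := e w; rewrite pq1 // pq2 //.
  exists (W1 `&` W2), (fun w => cl (inr (vadd (q1' w) (q2 w)))); split=> //.
  * by move=> w [/W1U].
  * by apply: plot_gclass_inr; exact: plot_add.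
  * by move=> w /[dup] Ww [w1 w2] /=; rewrite pq1 // pq2 // [gclass _ (inl _)]eq // cl_addr.
+ have [|q2' [hq eq pr]] := mix _ _ _ Wu hq2' hq1'.
    by move=> w [w1 w2]; have := e w; rewrite pq1 // pq2 //.
  exists (W1 `&` W2), (fun w => cl (inr (vadd (q1 w) (q2' w)))); split=> //.
  * by move=> w [/W1U].
  * by apply: plot_gclass_inr; apply: plot_add => // w Ww; rewrite pr.
  * by move=> w /[dup] Ww [w1 w2] /=; rewrite pq1 // pq2 // [gclass _ (inl _)]eq // cl_addr.
+ have pr w : (W1 `&` W2) w -> pb_proj (q1 w) = pb_proj (q2 w).
    move=> [w1 w2]; have := e w; rewrite pq1 // pq2 // !glue_proj_class.
    exact: gclass_inr_inj.
  exists (W1 `&` W2), (fun w => cl (inr (vadd (q1 w) (q2 w)))); split=> //.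
  * by move=> w [/W1U].
  * by apply: plot_gclass_inr; exact: plot_add.
  * by move=> w /[dup] Ww [w1 w2] /=; rewrite pq1 // pq2 // cl_addr.
Qed.
Lemma glue_smooth_scale :
  @smooth (prodD (std R) V) V (fun z => glue_scale z.1 z.2).
Proof.
move=> n U p [[oU h1] h2]; apply: plot_local => // u Uu.
have [W [Wu WU [] [q hq pq]]] := glue_plot h2 Uu.
  exists W, (fun w => cl (inl (vscale (p w).1 (q w)))); split=> //.
    by apply: plot_gclass_inl; apply: plot_scale hq; exact: Cinfty_sub h1.
  by move=> w Ww /=; rewrite pq // cl_scalel.
exists W, (fun w => cl (inr (vscale (p w).1 (q w)))); split=> //.
  by apply: plot_gclass_inr; apply: plot_scale hq; exact: Cinfty_sub h1.
by move=> w Ww /=; rewrite pq // cl_scaler.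
Qed.
Lemma glue_smooth_zero : smooth glue_zero.
Proof.
move=> n U p hp; apply: plot_local; first exact: plot_open hp.
move=> u Uu; have [W [Wu WU [] [q hq pq]]] := glue_plot hp Uu.
  exists W, (fun w => cl (inl (vzero (q w)))); split=> //.
    by apply: plot_gclass_inl; exact: (smooth_zero hq).
  by move=> w Ww /=; rewrite pq // cl_zerol.
exists W, (fun w => cl (inr (vzero (q w)))); split=> //.
  by apply: plot_gclass_inr; exact: (smooth_zero hq).
by move=> w Ww /=; rewrite pq // cl_zeror.
Qed.

Definition glue_bundle : pseudo_bundle.
Proof.
refine (@PseudoBundle V X glue_proj glue_add glue_scale glue_zero
  _ _ _ _ _ _ _ _ _ _ _ _ _ _ _).
- move=> c d; rewrite /glue_add.
  have := greprK c; case ec : (grepr c) => [v|v] <-;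
    case ed : (grepr d) => [w|w] //; by rewrite !glue_proj_class /= proj_add.
- move=> a; elim/glue_ind => -[] v;
    by rewrite ?cl_scalel ?cl_scaler !glue_proj_class /= proj_scale.
- move=> x; rewrite -(greprK x); case: (grepr x) => y;
    by rewrite ?cl_zerol ?cl_zeror glue_proj_class /= proj_zero.
- move=> b c d bc cd; have [|] := glue_fibre3 bc cd => -[u [v [w [-> -> -> [uv vw]]]]].
    by rewrite !cl_addl ?proj_add // ?vaddA // uv.
  by rewrite !cl_addr vaddA.
- move=> c d cd; have [|] := glue_fibre2 cd => -[v [w [-> -> vw]]].
    by rewrite !cl_addl // vaddC.
  by rewrite !cl_addr vaddC.
- elim/glue_ind => -[] v; rewrite glue_proj_class /=.
    by rewrite cl_zerol cl_addl ?proj_zero // vadd0.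
  by rewrite cl_zeror cl_addr vadd0.
- elim/glue_ind => -[] v; rewrite glue_proj_class /=.
    by rewrite cl_zerol cl_scalel cl_addl ?proj_scale // vaddN.
  by rewrite cl_zeror cl_scaler cl_addr vaddN.
- by elim/glue_ind => -[] v; rewrite ?cl_scalel ?cl_scaler vscale1.
- by move=> a b; elim/glue_ind => -[] v;
    rewrite ?cl_scalel ?cl_scaler ?cl_scalel ?cl_scaler vscaleA.
- move=> a b; elim/glue_ind => -[] v.
    by rewrite !cl_scalel cl_addl ?proj_scale // vscaleDl.
  by rewrite !cl_scaler cl_addr vscaleDl.
- move=> a c d cd; have [|] := glue_fibre2 cd => -[v [w [-> -> vw]]].
    by rewrite cl_addl // !cl_scalel cl_addl ?proj_scale // vscaleDr.
  by rewrite cl_addr // !cl_scaler cl_addr vscaleDr.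
- exact: glue_smooth_proj.
- exact: glue_smooth_add.
- exact: glue_smooth_scale.
- exact: glue_smooth_zero.
Defined.
End GlueBundle.

Section Inverse.
Variables (X1 X2 : diffSpace) (Y : set X1) (f : subD Y -> X2).
(* When f is injective, inv_map f is f^-1 : f(Y) -> Y followed by the inclusion
   of Y in X1; in general it is a section of f. *)
Definition inv_pt (z : @subD X2 (range f)) : subD Y := s2val (cid2 (svalP z)).
Lemma inv_ptK z : f (inv_pt z) = sval z.
Proof. by rewrite /inv_pt; case: cid2. Qed.
Definition inv_map (z : @subD X2 (range f)) : X1 := sval (inv_pt z).
Lemma inv_map_inj : injective inv_map.
Proof.
move=> z z' /sub_inj e; apply: sub_inj.
by rewrite -!inv_ptK e.
Qed.
End Inverse.

Section DualMap.
Variables (B1 B2 : pseudo_bundle) (Y : set (pb_base B1)).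
Variables (f : subD Y -> pb_base B2) (ft : pb_total (restrict_bundle Y) -> pb_total B2).
Hypothesis ft_lift : smooth_linear_lift f ft.

Section At.
Variable l : pb_total (@restrict_bundle (dual_bundle B2) (range f)).
Let y : subD Y := inv_pt (pb_proj l).

(* For l over f y, the form on the fibre over y sending w to l (f~ w). *)
Definition dual_map_fun (w : pb_total B1) : R :=
  if pselect (pb_proj w = sval y) is left e
  then dfun (sval l) (ft (exist _ w (eq_ind_r Y (svalP y) e))) else 0.

Lemma dual_map_funE (w : pb_total (restrict_bundle Y)) : pb_proj w = y ->
  dual_map_fun (sval w) = dfun (sval l) (ft w).
Proof.
move=> e; rewrite /dual_map_fun; case: pselect => [h|[]]; last by rewrite -e.
by congr (dfun _ (ft _)); exact: sub_inj.
Qed.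

Lemma dual_map_typed (w : pb_total B1) : pb_proj w = sval y ->
  exists2 w' : pb_total (restrict_bundle Y), sval w' = w & pb_proj w' = y.
Proof.
move=> e; exists (exist _ w (eq_ind_r Y (svalP y) e)) => //.
exact: sub_inj.
Qed.

Lemma dual_map_pt (w : pb_total (restrict_bundle Y)) : pb_proj w = y ->
  pb_proj (ft w) = dpt (sval l).
Proof. by move=> e; have [_ -> _] := ft_lift; rewrite e inv_ptK. Qed.

Definition dual_map : pb_total (dual_bundle B1).
Proof.
refine (@DualVec B1 (sval y) dual_map_fun _ _ _ _).
- by move=> v nv; rewrite /dual_map_fun; case: pselect.
- move=> v w /dual_map_typed[v' <- ev] /dual_map_typed[w' <- ew].
  rewrite -[vadd _ _]/(sval (@vadd (restrict_bundle Y) v' w')) !dual_map_funE //; last first.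
    by rewrite proj_add.
  have [_ _ [hD _]] := ft_lift.
  by rewrite hD ?ew // dfunD //; exact: dual_map_pt.
- move=> a v /dual_map_typed[v' <- ev].
  rewrite -[vscale _ _]/(sval (@vscale (restrict_bundle Y) a v')) !dual_map_funE //; last first.
    by rewrite proj_scale.
  have [_ _ [_ hZ]] := ft_lift.
  by rewrite hZ ?ew // dfunZ //; exact: dual_map_pt.
- move=> n U p hp; split; first exact: plot_open hp.
  have [sft _ _] := ft_lift.
  have hv u : pb_proj (sval (p u)) = sval y := svalP (p u).
  pose p' u : pb_total (restrict_bundle Y) := exist _ (sval (p u)) (eq_ind_r Y (svalP y) (hv u)).
  have ep u : pb_proj (p' u) = y by apply: sub_inj; exact: hv.
  pose q u : @subD (pb_total B2) [set v | pb_proj v = dpt (sval l)] :=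
    exist _ (ft (p' u)) (dual_map_pt (ep u)).
  have hq : plot (@subD (pb_total B2) [set v | pb_proj v = dpt (sval l)]) U q.
    by apply: (sft n U p').
  have [oU] := dfun_smooth hq; apply: Cinfty_eq => // u Uu.
  by rewrite /= -(dual_map_funE (ep u)).
Defined.
End At.
End DualMap.

End Diffeology.

Arguments restrict_bundle {R} B A.
Arguments pb_diffeo {R} B B' F phi.
Arguments smooth_linear_lift {R} B1 B2 {Y} f ft.
Arguments inv_map {R X1 X2 Y} f z.
Arguments inv_map_inj {R X1 X2 Y} f.
Arguments dual_map {R B1 B2 Y f ft} ft_lift l.
Arguments glue_bundle {R} B1 B2 {Y f ft}.

(* Main.v *)
Require Import Defs.
From mathcomp Require Import all_boot all_order all_algebra.
From mathcomp Require Import all_classical all_reals.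
From mathcomp Require Import topology normedtype.
Set Implicit Arguments. Unset Strict Implicit. Unset Printing Implicit Defensive.

(** Write W for the glued bundle V1 u_ft V2 and W' for V2* u_ft* V1*.

    The hypothesis says that the dual map ft* from V2* over f(Y) to V1* over Y
    has a smooth two-sided inverse Phi.  As ft* covers inv_map f, reading ft*
    on the zero section shows that inv_map f is smooth.  The bases of W and W'
    are identified by exchanging the two summands ([glue_swap]).

    A linear form m on a fibre of W restricts along V1 -> W to a form on a
    fibre of V1, or along V2 -> W to a form on a fibre of V2, or both when the
    base point lies in the glued part.  In the last case the two restrictions
    correspond under ft* ([dual_map_pull]), so that they define one class in
    W': this is the map [dual_glue].  It is smooth because a plot of the glued
    base lifts locally to X1 or to X2, and restriction along a bundle morphism
    preserves plots ([plot_pullback]).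

    Conversely a form l on V2 extends to the fibre of W over the same point,
    which as a set is the fibre of V2 ([extendr]); a form l on V1 extends to W
    directly when its base point is outside Y, and as the extension of Phi l
    when it is in Y ([extendl]).  Both are smooth: evaluating on a plot of W
    that lifts to the other summand is possible only over Y, where ft
    transports vectors from V1 to V2 and Phi transports forms from V1* to V2*.
    They agree under ft* because Phi inverts it, hence they glue to the inverse
    [dual_unglue] by the universal property of the quotient
    ([smooth_glue_lift]). *)

Section Lemmas.
Import Order.TTheory GRing.Theory Num.Theory.
Import numFieldNormedType.Exports.
Local Open Scope classical_set_scope.
Local Open Scope ring_scope.
Variable R : realType.
Implicit Types (X Z : diffSpace R) (B : pseudo_bundle R).

Lemma smooth_local X Z (h : X -> Z) :
  (forall n (U : set 'rV[R]_n) p u, plot U p -> U u ->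
     exists W, [/\ open W, W u, W `<=` U & plot W (h \o p)]) -> smooth h.
Proof.
move=> H n U p hp; apply: plot_local; first exact: plot_open hp.
by move=> u Uu; have [W [oW Wu WU hW]] := H n U p u hp Uu; exists W, (h \o p).
Qed.

(** * Maps out of a gluing *)

Section GlueLift.
Variables (X1 X2 Z : diffSpace R) (Y : set X1) (f : subD Y -> X2).
Variables (h1 : X1 -> Z) (h2 : X2 -> Z).
Hypothesis h12 : forall y : subD Y, h1 (sval y) = h2 (f y).

Definition glue_lift (c : glueD f) : Z :=
  match grepr c with inl x => h1 x | inr x => h2 x end.

Lemma glue_lift_inl x : glue_lift (gclass f (inl x)) = h1 x.
Proof.
have [Yx|nYx] := pselect (Y x); last by rewrite /glue_lift grepr_class gnorm_out.
pose y : subD Y := exist _ x Yx.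
by rewrite /glue_lift grepr_class [Defs.gnorm _ _](gnorm_in f y) -h12.
Qed.

Lemma glue_lift_inr x : glue_lift (gclass f (inr x)) = h2 x.
Proof. by rewrite /glue_lift grepr_class. Qed.

(** A plot of the gluing lifts locally to one of the summands. *)
Lemma smooth_glue_lift : smooth h1 -> smooth h2 -> smooth glue_lift.
Proof.
move=> s1 s2; apply: smooth_local => n U p u hp Uu.
have [W [Wu WU [] [q hq pq]]] := glue_plot hp Uu;
    exists W; split=> //; try exact: plot_open hq.
  apply: (plot_eq (s1 _ _ _ hq)) => w Ww.
  by rewrite /= pq // glue_lift_inl.
apply: (plot_eq (s2 _ _ _ hq)) => w Ww.
by rewrite /= pq // glue_lift_inr.
Qed.
End GlueLift.

(** * Exchanging the two sides of a gluing *)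

Section GlueSwap.
Variables (X1 X2 : diffSpace R) (Y : set X1) (f : subD Y -> X2).
Variables (A : set X2) (g : subD A -> X1).

Definition glue_swap : glueD f -> glueD g :=
  glue_lift (fun x => gclass g (inr x)) (fun x => gclass g (inl x)).

Hypothesis fg : forall y : subD Y, exists2 z : subD A, sval z = f y & g z = sval y.

Lemma glue_swap_compat (y : subD Y) :
  gclass g (inr (sval y)) = gclass g (inl (f y)).
Proof. by have [z <- <-] := fg y; rewrite gclass_in. Qed.

Lemma glue_swap_inl x : glue_swap (gclass f (inl x)) = gclass g (inr x).
Proof. exact/glue_lift_inl/glue_swap_compat. Qed.

Lemma glue_swap_inr x : glue_swap (gclass f (inr x)) = gclass g (inl x).
Proof. exact: glue_lift_inr. Qed.

Lemma smooth_glue_swap : smooth glue_swap.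
Proof.
apply: smooth_glue_lift; first exact: glue_swap_compat.
  by move=> n U p; exact: plot_gclass_inr.
by move=> n U p; exact: plot_gclass_inl.
Qed.
End GlueSwap.

Lemma glue_swapK (X1 X2 : diffSpace R) (Y : set X1) (f : subD Y -> X2)
    (A : set X2) (g : subD A -> X1) :
  (forall y : subD Y, exists2 z : subD A, sval z = f y & g z = sval y) ->
  (forall z : subD A, exists2 y : subD Y, sval y = g z & f y = sval z) ->
  cancel (@glue_swap _ _ _ f _ g) (@glue_swap _ _ _ g _ f).
Proof.
move=> fg gf c; rewrite -(greprK c); case: (grepr c) => x.
  by rewrite (glue_swap_inl fg) glue_swap_inr.
by rewrite glue_swap_inr (glue_swap_inl gf).
Qed.

Lemma inv_mapK (X1 X2 : diffSpace R) (Y : set X1) (f : subD Y -> X2)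
    (z : subD (range f)) : exists2 y : subD Y, sval y = inv_map f z & f y = sval z.
Proof. by exists (inv_pt z) => //; exact: inv_ptK. Qed.

Lemma inv_mapKV (X1 X2 : diffSpace R) (Y : set X1) (f : subD Y -> X2) :
  injective f ->
  forall y : subD Y, exists2 z : subD (range f), sval z = f y & inv_map f z = sval y.
Proof.
move=> fi y.
pose z : subD (range f) := exist _ (f y) (ex_intro2 _ _ y Logic.I erefl).
by exists z => //; rewrite /inv_map; congr sval; apply: fi; rewrite inv_ptK.
Qed.

(** * Plots of a dual bundle *)

Section DualPlots.
Variable B : pseudo_bundle R.

(** The pairing of a plot of the dual with a plot of the bundle over the same
    parameter domain: the diagonal case of the definition of a dual plot. *)
Lemma Cinfty_dual_eval n (U : set 'rV[R]_n) p v :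
  @plot R (dualD B) n U p -> @plot R (pb_total B) n U v ->
  (forall u, U u -> dpt (p u) = pb_proj (v u)) ->
  Cinfty U (fun u => dfun (p u) (v u) : R).
Proof.
move=> /[dup] /plot_open oU /dual_plotP[_ hp] hv e.
by apply: (hp n U id v) => //; exact: Cinfty_id.
Qed.

(** The diagonal case suffices to test smoothness of a map into the dual, since
    plots of the source may be reparametrized. *)
Lemma smooth_to_dual X (h : X -> dualD B) :
  smooth (fun x => dpt (h x)) ->
  (forall n (U : set 'rV[R]_n) p v, plot U p -> @plot R (pb_total B) n U v ->
     (forall u, U u -> dpt (h (p u)) = pb_proj (v u)) ->
     Cinfty U (fun u => dfun (h (p u)) (v u) : R)) ->
  smooth h.
Proof.
move=> s0 s n U p hp; apply/dual_plotP; split; first exact: s0.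
move=> k W a v oW ha aU hv e.
by apply: (s _ _ (p \o a)) => //; exact: plot_comp hp _ _ _.
Qed.
End DualPlots.

(** * Restriction of linear forms along a bundle morphism *)

Definition bundle_morphism B B' (F : pb_total B -> pb_total B')
    (phi : pb_base B -> pb_base B') : Prop :=
  [/\ smooth F, forall v, pb_proj (F v) = phi (pb_proj v) & fibrewise_linear F].

Section Pullback.
Variables (B B' : pseudo_bundle R) (F : pb_total B -> pb_total B').
Variables (phi : pb_base B -> pb_base B').
Hypothesis morF : bundle_morphism F phi.

Section At.
Variables (x : pb_base B) (m : dual_vec B').

Definition pullback_fun (v : pb_total B) : R :=
  if pselect (pb_proj v = x) then dfun m (F v) else 0.

Lemma pullback_funE v : pb_proj v = x -> pullback_fun v = dfun m (F v).
Proof. by rewrite /pullback_fun; case: pselect. Qed.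

Lemma pullback_fun_supp v : pb_proj v <> x -> pullback_fun v = 0.
Proof. by rewrite /pullback_fun; case: pselect. Qed.

Hypothesis xm : dpt m = phi x.

Lemma pullback_funD v w : pb_proj v = x -> pb_proj w = x ->
  pullback_fun (vadd v w) = pullback_fun v + pullback_fun w.
Proof.
have [_ pF [FD _]] := morF; move=> hv hw.
by rewrite !pullback_funE ?proj_add // FD ?hv // dfunD // pF ?hv ?hw.
Qed.

Lemma pullback_funZ a v : pb_proj v = x ->
  pullback_fun (vscale a v) = a * pullback_fun v.
Proof.
have [_ pF [_ FZ]] := morF; move=> hv.
by rewrite !pullback_funE ?proj_scale // FZ dfunZ // pF hv.
Qed.

Lemma pullback_fun_smooth :
  @smooth R (@subD R (pb_total B) [set v | pb_proj v = x]) (std R)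
    (fun v => pullback_fun (sval v)).
Proof.
have [sF pF _] := morF; move=> n U p hp; have oU := plot_open hp; split=> //.
have e u : pb_proj (sval (p u)) = x := svalP (p u).
apply: (@Cinfty_eq _ _ _ _ (fun u => dfun m (F (sval (p u))) : R)) => //.
  by move=> u _ /=; rewrite pullback_funE.
apply: (@Cinfty_dual_eval B' _ _ (fun=> m)); first exact: dual_plot_cst.
  exact: sF hp.
by move=> u _ /=; rewrite pF e.
Qed.

Definition pullback_at : dual_vec B :=
  DualVec pullback_fun_supp pullback_funD pullback_funZ pullback_fun_smooth.
End At.

(** The point x is an argument because phi need not be injective: the base point
    of m does not determine the fibre on which m o F is to be read.  When m does
    not lie over phi x the value is the zero form, which makes the map total. *)
Definition pullback x m : dual_vec B :=
  if pselect (dpt m = phi x) is left xm then pullback_at xm else dual_zero x.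

Lemma dpt_pullback x m : dpt (pullback x m) = x.
Proof. by rewrite /pullback; case: pselect. Qed.

Lemma dfun_pullback x m v : dpt m = phi x -> pb_proj v = x ->
  dfun (pullback x m) v = dfun m (F v).
Proof. by move=> xm; rewrite /pullback; case: pselect => // h; exact: pullback_funE. Qed.

Lemma pullback_add x m m' : dpt m = phi x -> dpt m' = phi x ->
  pullback x (dual_add m m') = dual_add (pullback x m) (pullback x m').
Proof.
move=> mx m'x; have mm' : dpt m = dpt m' by rewrite mx.
apply: dual_vec_eq; first by rewrite dpt_add !dpt_pullback.
move=> v; rewrite dpt_pullback => vx.
by rewrite dfun_add ?dpt_pullback // !dfun_pullback ?dpt_add // dfun_add.
Qed.

Lemma pullback_scale x a m : dpt m = phi x ->
  pullback x (dual_scale a m) = dual_scale a (pullback x m).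
Proof.
move=> mx; apply: dual_vec_eq; first by rewrite /= !dpt_pullback.
by move=> v; rewrite dpt_pullback => vx; rewrite /= !dfun_pullback.
Qed.

(** A lift b of the base points has to be supplied with the plot p; in a gluing
    such lifts exist locally. *)
Lemma plot_pullback n (U : set 'rV[R]_n) b p :
  @plot R (pb_base B) n U b -> @plot R (dualD B') n U p ->
  (forall u, U u -> dpt (p u) = phi (b u)) ->
  @plot R (dualD B) n U (fun u => pullback (b u) (p u)).
Proof.
move=> hb hp e; apply/dual_plotP; split.
  by apply: (plot_eq hb) => u _ /=; rewrite dpt_pullback.
move=> k W a v oW ha aU hv; have [sF pF _] := morF.
move=> ev; have bv w : W w -> pb_proj (v w) = b (a w).
  by move=> Ww; rewrite -ev // dpt_pullback.
apply: (@Cinfty_eq _ _ _ _ (fun w => dfun (p (a w)) (F (v w)) : R)) => //.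
  by move=> w Ww /=; rewrite dfun_pullback ?bv ?e //; exact: aU.
apply: Cinfty_dual_eval; first exact: plot_comp hp _ _ _.
  exact: sF hv.
by move=> w Ww; rewrite /= pF bv // e //; exact: aU.
Qed.
End Pullback.

(** * The glued bundle: summands, fibres, extension of linear forms *)

Section GlueMaps.
Variables (B1 B2 : pseudo_bundle R) (Y : set (pb_base B1)).
Variables (f : subD Y -> pb_base B2) (ft : pb_total (restrict_bundle B1 Y) -> pb_total B2).
Hypotheses (f_inj : injective f) (ft_lift : smooth_linear_lift B1 B2 f ft).
Let W := glue_bundle B1 B2 f_inj ft_lift.

Lemma glue_inl_morphism : bundle_morphism (B' := W)
  (fun v => gclass ft (inl v)) (fun x => gclass f (inl x)).
Proof.
split; first by move=> n U p; exact: plot_gclass_inl.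
  by move=> v; exact: glue_proj_class.
split; first by move=> v w vw; rewrite /= (cl_addl ft_lift).
by move=> a v; rewrite /= (cl_scalel ft_lift).
Qed.

Lemma glue_inr_morphism : bundle_morphism (B' := W)
  (fun v => gclass ft (inr v)) (fun x => gclass f (inr x)).
Proof.
split; first by move=> n U p; exact: plot_gclass_inr.
  by move=> v; exact: glue_proj_class.
split; first by move=> v w vw; rewrite /= cl_addr.
by move=> a v; rewrite /= cl_scaler.
Qed.

(** Every class has its canonical representative in V2 as soon as its base point
    comes from X2. *)
Lemma glue_fibre_inr (c : pb_total W) x : pb_proj c = gclass f (inr x) ->
  exists2 v, pb_proj v = x & c = gclass ft (inr v).
Proof.
move=> e; have := congr1 (@grepr _ _ _ _ _) e.
rewrite /= (grepr_proj ft_lift) grepr_class.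
by have := greprK c; case: (grepr c) => v <- //= -[<-]; exists v.
Qed.

Lemma glue_fibre_inl (c : pb_total W) x : ~ Y x -> pb_proj c = gclass f (inl x) ->
  exists2 v, pb_proj v = x & c = gclass ft (inl v).
Proof.
move=> nY e; have := congr1 (@grepr _ _ _ _ _) e.
rewrite /= (grepr_proj ft_lift) grepr_class gnorm_out //.
by have := greprK c; case: (grepr c) => v <- //= -[<-]; exists v.
Qed.

Lemma glue_inl_inr v x : gclass f (inl (pb_proj v)) = gclass f (inr x) ->
  exists2 v' : pb_total (restrict_bundle B1 Y), sval v' = v & f (pb_proj v') = x.
Proof.
by move=> /gclass_mix[h <-]; exists (exist _ v h) => //; congr f; exact: sub_inj.
Qed.

(** Over a point of X2 the canonical representatives all lie in V2, so l can be
    evaluated on them. *)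
Definition extendr_fun (l : dual_vec B2) (c : pb_total W) : R :=
  if grepr (c : glueD ft) is inr v then dfun l v else 0.

Lemma extendr_fun_inr l v : extendr_fun l (gclass ft (inr v)) = dfun l v.
Proof. by rewrite /extendr_fun grepr_class. Qed.

Lemma extendr_fun_in l (v : pb_total (restrict_bundle B1 Y)) :
  extendr_fun l (gclass ft (inl (sval v))) = dfun l (ft v).
Proof. by rewrite [gclass _ _](gclass_in ft v) extendr_fun_inr. Qed.

(** Where v lifts to a plot q of V1 instead of V2, its base points are forced into
    Y, so that ft o q is a lift to V2.  Constant p gives the smoothness of a
    single extended form; varying p that of the extension map. *)
Lemma Cinfty_extendr n (U : set 'rV[R]_n) p v :
  @plot R (dualD B2) n U p -> @plot R (pb_total W) n U v ->
  (forall u, U u -> pb_proj (v u) = gclass f (inr (dpt (p u)))) ->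
  Cinfty U (fun u => extendr_fun (p u) (v u) : R).
Proof.
move=> hp hv e; have [sft pft _] := ft_lift.
apply: Cinfty_local => u Uu; have [A [Au AU [] [q hq vq]]] := glue_plot hv Uu.
  have eq w : A w -> gclass f (inl (pb_proj (q w))) = gclass f (inr (dpt (p w))).
    by move=> Aw; rewrite -e ?vq //=; [rewrite (glue_proj_class ft_lift)|exact: AU].
  have [q' hq' qq'] := @plot_sub_ex _ _ (@pb_proj R B1 @^-1` Y) _ _ _ _ hq Au
    (fun w Aw => let: ex_intro h _ := gclass_mix (eq w Aw) in h).
  exists A; split=> //; first exact: plot_open hq.
  apply: (@Cinfty_eq _ _ _ _ (fun w => dfun (p w) (ft (q' w)) : R)).
  - exact: plot_open hq.
  - by move=> w Aw; rewrite vq // -qq' // extendr_fun_in.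
  apply: Cinfty_dual_eval; first exact: plot_sub hp (plot_open hq) AU.
    exact: (sft _ _ _ hq').
  move=> w Aw; rewrite pft.
  have := eq w Aw; rewrite -qq' // => /(glue_inl_inr (v := sval (q' w)))[z /sub_inj -> <-].
  by [].
exists A; split=> //; first exact: plot_open hq.
apply: (@Cinfty_eq _ _ _ _ (fun w => dfun (p w) (q w) : R)).
- exact: plot_open hq.
- by move=> w Aw; rewrite vq // extendr_fun_inr.
apply: (Cinfty_dual_eval _ hq); first exact: plot_sub hp (plot_open hq) AU.
move=> w Aw; apply/esym/(@gclass_inr_inj _ _ _ _ f).
by rewrite -e ?vq //=; [rewrite (glue_proj_class ft_lift)|exact: AU].
Qed.

Section ExtendR.
Variable l : dual_vec B2.
Let x : pb_base W := gclass f (inr (dpt l)).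

Lemma extendr_supp c : pb_proj c <> x -> extendr_fun l c = 0.
Proof.
rewrite /extendr_fun; have := greprK c; case: (grepr c) => // v <-.
rewrite /= (glue_proj_class ft_lift) => ne; apply: dfun_supp => e; apply: ne.
by rewrite /= e.
Qed.

Lemma extendr_funD c d : pb_proj c = x -> pb_proj d = x ->
  extendr_fun l (vadd c d) = extendr_fun l c + extendr_fun l d.
Proof.
move=> /glue_fibre_inr[v hv ->] /glue_fibre_inr[w hw ->].
by rewrite /= cl_addr !extendr_fun_inr dfunD.
Qed.

Lemma extendr_funZ a c : pb_proj c = x ->
  extendr_fun l (vscale a c) = a * extendr_fun l c.
Proof.
by move=> /glue_fibre_inr[v hv ->]; rewrite /= cl_scaler !extendr_fun_inr dfunZ.
Qed.

Lemma extendr_smooth :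
  @smooth R (@subD R (pb_total W) [set c | pb_proj c = x]) (std R)
    (fun c => extendr_fun l (sval c)).
Proof.
move=> n U p hp; have oU := plot_open hp; split=> //.
apply: (@Cinfty_extendr _ _ (fun=> l)) => //; first exact: dual_plot_cst.
by move=> u _; exact: (svalP (p u)).
Qed.

Definition extendr : dual_vec W :=
  DualVec extendr_supp extendr_funD extendr_funZ extendr_smooth.
End ExtendR.

Lemma smooth_extendr : @smooth R (dualD B2) (dualD W) extendr.
Proof.
apply: smooth_to_dual.
  by move=> n U p [hp _]; exact: plot_gclass_inr hp.
by move=> n U p v hp hv e; apply: Cinfty_extendr => // u /e <-.
Qed.

Section ExtendL.
Variable l : dual_vec B1.
Hypothesis nY : ~ Y (dpt l).
Let x : pb_base W := gclass f (inl (dpt l)).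

(** Over a point of X1 outside Y the canonical representatives lie in V1. *)
Definition extendl_fun (c : pb_total W) : R :=
  if grepr (c : glueD ft) is inl v then dfun l v else 0.

(** When v lies over Y its canonical representative is in V2 and the left side is
    0; so is the right side, since l lives over a point outside Y. *)
Lemma extendl_fun_inl v : extendl_fun (gclass ft (inl v)) = dfun l v.
Proof.
have [Yv|nYv] := pselect (Y (pb_proj v)); last first.
  by rewrite /extendl_fun grepr_class gnorm_out.
rewrite dfun_supp => [|vl]; last by apply: nY; rewrite -vl.
pose v' : pb_total (restrict_bundle B1 Y) := exist _ v Yv.
by rewrite /extendl_fun [gclass _ _](gclass_in ft v') grepr_class.
Qed.

Lemma extendl_supp c : pb_proj c <> x -> extendl_fun c = 0.
Proof.
rewrite /extendl_fun; have := greprK c; case: (grepr c) => // v <-.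
rewrite /= (glue_proj_class ft_lift) => ne; apply: dfun_supp => e; apply: ne.
by rewrite /= e.
Qed.

Lemma extendl_funD c d : pb_proj c = x -> pb_proj d = x ->
  extendl_fun (vadd c d) = extendl_fun c + extendl_fun d.
Proof.
move=> /(glue_fibre_inl nY)[v hv ->] /(glue_fibre_inl nY)[w hw ->].
by rewrite /= (cl_addl ft_lift) ?extendl_fun_inl ?dfunD // hv.
Qed.

Lemma extendl_funZ a c : pb_proj c = x ->
  extendl_fun (vscale a c) = a * extendl_fun c.
Proof.
move=> /(glue_fibre_inl nY)[v hv ->].
by rewrite /= (cl_scalel ft_lift) !extendl_fun_inl dfunZ.
Qed.

Lemma extendl_smooth :
  @smooth R (@subD R (pb_total W) [set c | pb_proj c = x]) (std R)
    (fun c => extendl_fun (sval c)).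
Proof.
move=> n U p hp; have oU := plot_open hp; split=> //.
have e u : pb_proj (sval (p u)) = x := svalP (p u).
apply: Cinfty_local => u Uu; have [A [Au AU [] [q hq vq]]] := glue_plot hp Uu; last first.
  have := e u; rewrite vq //= (glue_proj_class ft_lift) => /esym/gclass_mix[h _].
  by case: nY.
exists A; split=> //; first exact: plot_open hq.
apply: (@Cinfty_eq _ _ _ _ (fun w => dfun l (q w) : R)).
- exact: plot_open hq.
- by move=> w Aw; rewrite /= vq // extendl_fun_inl.
apply: (Cinfty_dual_eval (p := fun=> l) _ hq).
  by apply: dual_plot_cst; exact: plot_open hq.
move=> w Aw; have := e w; rewrite vq //= (glue_proj_class ft_lift) => /(gclass_inl_inj f_inj).
by [].
Qed.

Definition extendl_off : dual_vec W :=
  DualVec extendl_supp extendl_funD extendl_funZ extendl_smooth.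
End ExtendL.
End GlueMaps.

(** * The dual of the fibrewise linear lift *)

Section DualMap.
Variables (B1 B2 : pseudo_bundle R) (Y : set (pb_base B1)).
Variables (f : subD Y -> pb_base B2) (ft : pb_total (restrict_bundle B1 Y) -> pb_total B2).
Hypotheses (f_inj : injective f) (ft_lift : smooth_linear_lift B1 B2 f ft).
Local Notation D := (dual_map ft_lift).

Lemma inv_pt_eq l y : dpt (sval l) = f y ->
  inv_pt (pb_proj (l : pb_total (restrict_bundle (dual_bundle B2) (range f)))) = y.
Proof. by move=> e; apply: f_inj; rewrite inv_ptK. Qed.

Lemma dpt_dual_map l y : dpt (sval l) = f y -> dpt (D l) = sval y.
Proof. by move=> e; rewrite -(inv_pt_eq e). Qed.

Lemma dfun_dual_map l y (v : pb_total (restrict_bundle B1 Y)) :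
  dpt (sval l) = f y -> pb_proj v = y -> dfun (D l) (sval v) = dfun (sval l) (ft v).
Proof. by move=> e vy; apply: dual_map_funE; rewrite (inv_pt_eq e). Qed.

Lemma dual_map_eq l l1 y : dpt (sval l) = f y -> dpt l1 = sval y ->
  (forall v : pb_total (restrict_bundle B1 Y), pb_proj v = y ->
     dfun l1 (sval v) = dfun (sval l) (ft v)) ->
  D l = l1.
Proof.
move=> e e1 h; apply: dual_vec_eq; first by rewrite (dpt_dual_map e).
move=> v; rewrite (dpt_dual_map e) => vy.
pose v' : pb_total (restrict_bundle B1 Y) := exist _ v (eq_ind_r Y (svalP y) vy).
have v'y : pb_proj v' = y by exact: sub_inj.
by rewrite -[v]/(sval v') (dfun_dual_map e) // h.
Qed.

Lemma dual_map_linear : fibrewise_linear D.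
Proof.
split=> [l l' ll'|a l]; have [y _ /esym ey] := inv_mapK (pb_proj l).
  have e : dpt (sval l) = dpt (sval l') := congr1 sval ll'.
  have ey' : dpt (sval l') = f y by rewrite -e.
  apply: (@dual_map_eq _ _ y).
  - exact: (etrans (dpt_add (sval l) (sval l')) ey).
  - exact: (etrans (dpt_add (D l) (D l')) (dpt_dual_map ey)).
  - move=> v vy; have eD : dpt (D l) = dpt (D l').
      by rewrite (dpt_dual_map ey) (dpt_dual_map ey').
    rewrite [LHS](dfun_add _ eD) [RHS](dfun_add _ e).
    by rewrite (dfun_dual_map ey) // (dfun_dual_map ey').
apply: (@dual_map_eq _ _ y); [exact: ey|exact: (dpt_dual_map ey)|].
by move=> v vy; congr (a * _); exact: (dfun_dual_map ey vy).
Qed.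
End DualMap.

(** * The dual of a gluing is the gluing of the duals *)

Section DualOfGluing.
Variables (B1 B2 : pseudo_bundle R) (Y : set (pb_base B1)).
Variables (f : subD Y -> pb_base B2) (ft : pb_total (restrict_bundle B1 Y) -> pb_total B2).
Hypotheses (f_inj : injective f) (ft_lift : smooth_linear_lift B1 B2 f ft).
Local Notation D := (dual_map ft_lift).
Let W := glue_bundle B1 B2 f_inj ft_lift.

Variable Phi : pb_total (restrict_bundle (dual_bundle B1) Y) ->
               pb_total (restrict_bundle (dual_bundle B2) (range f)).
Hypotheses (sPhi : smooth Phi) (PhiK : forall a, D (Phi a) = sval a)
           (DK : injective D).
Hypothesis D_lift : smooth_linear_lift (dual_bundle B2) (dual_bundle B1) (inv_map f) D.
Let W' := glue_bundle (dual_bundle B2) (dual_bundle B1) (inv_map_inj f) D_lift.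

(** Phi covers f since ft* covers the inverse of f. *)
Lemma dpt_Phi a : dpt (sval (Phi a)) = f (pb_proj a).
Proof.
have [y ey fy] := inv_mapK (pb_proj (Phi a)).
rewrite -[LHS]fy; congr f; apply: sub_inj.
by rewrite ey -[RHS]/(dpt (sval a)) -(PhiK a).
Qed.

Lemma dfun_Phi (a : pb_total (restrict_bundle (dual_bundle B1) Y))
    (v : pb_total (restrict_bundle B1 Y)) : pb_proj v = pb_proj a ->
  dfun (sval (Phi a)) (ft v) = dfun (sval a) (sval v).
Proof. by move=> va; rewrite -(dfun_dual_map f_inj ft_lift (dpt_Phi a) va) PhiK. Qed.

(** Over Y the form l must be moved to V2 before it can be extended: the fibre of W
    is that of V2, and ft need not be onto, so that l alone does not determine
    the values of its extension. *)
Definition extendl (l : dual_vec B1) : dual_vec W :=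
  match pselect (Y (dpt l)) with
  | left h => extendr f_inj ft_lift (sval (Phi (exist _ l h)))
  | right h => extendl_off f_inj ft_lift h
  end.

Lemma extendl_in a : extendl (sval a) = extendr f_inj ft_lift (sval (Phi a)).
Proof.
rewrite /extendl; case: pselect => [h|]; last by have := svalP a.
by congr (extendr _ _ (sval (Phi _))); exact: sub_inj.
Qed.

Lemma dpt_extendl l : dpt (extendl l) = gclass f (inl (dpt l)).
Proof.
rewrite /extendl; case: pselect => // h.
by rewrite /= dpt_Phi -gclass_in.
Qed.

Lemma dfun_extendl_inl l v : dfun (extendl l) (gclass ft (inl v)) = dfun l v.
Proof.
have [vl|nvl] := pselect (pb_proj v = dpt l); last first.
  rewrite dfun_supp ?dfun_supp // dpt_extendl /= (glue_proj_class ft_lift).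
  by move=> /(gclass_inl_inj f_inj).
rewrite /extendl; case: pselect => h /=; last exact: extendl_fun_inl.
pose v' : pb_total (restrict_bundle B1 Y) := exist _ v (eq_ind_r Y h vl).
rewrite [LHS](extendr_fun_in f_inj ft_lift _ v') dfun_Phi //.
exact: sub_inj.
Qed.

(** Paired with a plot of V1 the extension of p is p itself; paired with a plot of
    V2 the base points lie in Y and the smoothness of Phi is what is required. *)
Lemma smooth_extendl : @smooth R (dualD B1) (dualD W) extendl.
Proof.
apply: smooth_to_dual.
  move=> n U p [hp _]; apply: (plot_eq (plot_gclass_inl f hp)) => u _ /=.
  by rewrite dpt_extendl.
move=> n U p v hp hv e; apply: Cinfty_local => u Uu.
have [A [Au AU [] [q hq vq]]] := glue_plot hv Uu;
  exists A; split=> //; try exact: plot_open hq.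
all: have hpA := plot_sub hp (plot_open hq) AU.
  apply: (@Cinfty_eq _ _ _ _ (fun w => dfun (p w) (q w) : R)).
  - exact: plot_open hq.
  - by move=> w Aw; rewrite vq // dfun_extendl_inl.
  apply: Cinfty_dual_eval => // w Aw; apply: (gclass_inl_inj f_inj).
  by have := e w (AU _ Aw); rewrite dpt_extendl vq //= (glue_proj_class ft_lift).
have eq w : A w -> gclass f (inl (dpt (p w))) = gclass f (inr (pb_proj (q w))).
  by move=> Aw; have := e w (AU _ Aw); rewrite dpt_extendl vq //= (glue_proj_class ft_lift).
have [a ha pa] := @plot_sub_ex _ _ (@pb_proj R (dual_bundle B1) @^-1` Y) _ _ _ _ hpA Au
    (fun w Aw => let: ex_intro h _ := gclass_mix (eq w Aw) in h).
apply: (@Cinfty_eq _ _ _ _ (fun w => dfun (sval (Phi (a w))) (q w) : R)).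
- exact: plot_open hq.
- by move=> w Aw; rewrite vq // -pa // extendl_in /= extendr_fun_inr.
apply: Cinfty_dual_eval => //; first exact: (sPhi ha).
move=> w Aw; rewrite dpt_Phi; have := eq w Aw; rewrite -pa //.
by move=> /gclass_mix[h <-]; congr f; exact: sub_inj.
Qed.

Definition dual_unglue : pb_total W' -> pb_total (dual_bundle W) :=
  glue_lift (Z := dualD W) (f := D : subD _ -> dualD B1)
    (extendr f_inj ft_lift : dualD B2 -> dualD W) (extendl : dualD B1 -> dualD W).

Lemma dual_unglue_compat
    (l : pb_total (restrict_bundle (dual_bundle B2) (range f))) : extendr f_inj ft_lift (sval l) = extendl (D l).
Proof.
have [y _ ey] := inv_mapK (pb_proj l).
have h : Y (dpt (D l)) by exact: svalP.
pose a : pb_total (restrict_bundle (dual_bundle B1) Y) := exist _ (D l) h.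
have -> : l = Phi a by apply: DK; rewrite PhiK.
by rewrite PhiK extendl_in.
Qed.

Lemma dual_unglue_inl l : dual_unglue (gclass D (inl l)) = extendr f_inj ft_lift l.
Proof. exact/glue_lift_inl/dual_unglue_compat. Qed.

Lemma dual_unglue_inr l : dual_unglue (gclass D (inr l)) = extendl l.
Proof. exact: glue_lift_inr. Qed.

Lemma smooth_dual_unglue : smooth dual_unglue.
Proof.
apply: smooth_glue_lift; first exact: dual_unglue_compat.
  exact: smooth_extendr.
exact: smooth_extendl.
Qed.

Local Notation pull1 := (pullback (glue_inl_morphism f_inj ft_lift)).
Local Notation pull2 := (pullback (glue_inr_morphism f_inj ft_lift)).

(** Defined through the canonical representative of the base point;
    [dual_glue_inl] and [dual_glue_inr] show that every representative gives the
    same class. *)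
Definition dual_glue (m : pb_total (dual_bundle W)) : pb_total W' :=
  match grepr (dpt m) with
  | inl x => gclass D (inr (pull1 x m))
  | inr x => gclass D (inl (pull2 x m))
  end.

Lemma dual_glue_inr (m : dual_vec W) x : dpt m = gclass f (inr x) ->
  dual_glue m = gclass D (inl (pull2 x m)).
Proof. by rewrite /dual_glue => ->; rewrite grepr_class. Qed.

(** The two restrictions of a form over the glued part correspond under ft*,
    because w and ft w have the same class in W. *)
Lemma dual_map_pull (m : dual_vec W) (y : subD Y)
    (l : pb_total (restrict_bundle (dual_bundle B2) (range f))) :
  dpt m = gclass f (inr (f y)) -> sval l = pull2 (f y) m -> D l = pull1 (sval y) m.
Proof.
move=> my el; apply: (dual_map_eq f_inj).
- by rewrite el dpt_pullback.
- by rewrite dpt_pullback.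
move=> v vy; rewrite el !dfun_pullback //.
- by rewrite [gclass _ (inl _)]gclass_in.
- by have [_ -> _] := ft_lift; rewrite vy.
- by rewrite my gclass_in.
- by rewrite -vy.
Qed.

Lemma dual_glue_inl (m : dual_vec W) x : dpt m = gclass f (inl x) ->
  dual_glue m = gclass D (inr (pull1 x m)).
Proof.
have [Yx|nYx] := pselect (Y x) => mx; last first.
  by rewrite /dual_glue mx grepr_class gnorm_out.
pose y : subD Y := exist _ x Yx.
have my : dpt m = gclass f (inr (f y)) by rewrite mx -gclass_in.
have rl : range f (dpt (pull2 (f y) m)) by rewrite dpt_pullback; exists y.
pose l : pb_total (restrict_bundle (dual_bundle B2) (range f)) :=
  exist _ (pull2 (f y) m) rl.
by rewrite (dual_glue_inr my) [LHS](gclass_in D l) (dual_map_pull my (l := l)).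
Qed.

Lemma smooth_dual_glue : smooth dual_glue.
Proof.
apply: smooth_local => n U p u hp Uu.
have hb : plot U (fun u => dpt (p u)) by case: hp.
have [A [Au AU [] [b hb' pb]]] := glue_plot hb Uu;
  exists A; split=> //; try exact: plot_open hb'.
all: have hpA := plot_sub hp (plot_open hb') AU.
  apply: (plot_eq (plot_gclass_inr D (plot_pullback (glue_inl_morphism f_inj ft_lift) hb' hpA pb))).
  by move=> w Aw /=; rewrite (dual_glue_inl (pb w Aw)).
apply: (plot_eq (plot_gclass_inl D (plot_pullback (glue_inr_morphism f_inj ft_lift) hb' hpA pb))).
by move=> w Aw /=; rewrite (dual_glue_inr (pb w Aw)).
Qed.

Lemma glue_case (x : pb_base W) :
  (exists x2, x = gclass f (inr x2)) \/ (exists2 x1, ~ Y x1 & x = gclass f (inl x1)).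
Proof.
have := greprK x; case e : (grepr x) => [x1|x2] <-; last by left; exists x2.
by right; exists x1 => //; exact: grepr_out e.
Qed.

Lemma dual_glueK : cancel dual_glue dual_unglue.
Proof.
move=> m; have [[x mx]|[x nY mx]] := glue_case (dpt m).
  rewrite (dual_glue_inr mx) dual_unglue_inl; apply: dual_vec_eq.
    by rewrite /= dpt_pullback.
  rewrite /= dpt_pullback => c /glue_fibre_inr[v vx ->].
  by rewrite extendr_fun_inr dfun_pullback.
rewrite (dual_glue_inl mx) dual_unglue_inr; apply: dual_vec_eq.
  by rewrite dpt_extendl dpt_pullback.
rewrite dpt_extendl dpt_pullback => c /(glue_fibre_inl nY)[v vx ->].
by rewrite dfun_extendl_inl dfun_pullback.
Qed.

Lemma dual_unglueK : cancel dual_unglue dual_glue.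
Proof.
apply: glue_ind => -[] l.
  rewrite dual_unglue_inl (@dual_glue_inr _ (dpt l)) //; congr (gclass D (inl _)).
  apply: dual_vec_eq; first by rewrite dpt_pullback.
  by rewrite dpt_pullback => v vl; rewrite dfun_pullback //= extendr_fun_inr.
rewrite dual_unglue_inr (@dual_glue_inl _ (dpt l)) ?dpt_extendl //.
congr (gclass D (inr _)); apply: dual_vec_eq; first by rewrite dpt_pullback.
rewrite dpt_pullback => v vl.
by rewrite dfun_pullback ?dpt_extendl // dfun_extendl_inl.
Qed.

Lemma dual_glue_proj m : pb_proj (dual_glue m) = glue_swap (inv_map f) (dpt m).
Proof.
have [[x mx]|[x nY mx]] := glue_case (dpt m).
  rewrite (dual_glue_inr mx) mx glue_swap_inr /= (glue_proj_class D_lift) /=.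
  by rewrite dpt_pullback.
rewrite (dual_glue_inl mx) mx (glue_swap_inl (inv_mapKV f_inj)) /=.
by rewrite (glue_proj_class D_lift) /= dpt_pullback.
Qed.

Lemma dual_glue_linear : fibrewise_linear dual_glue.
Proof.
split=> [m m' mm'|a m]; have [[x mx]|[x nY mx]] := glue_case (dpt m).
- have m'x : dpt m' = gclass f (inr x) by rewrite -mx.
  rewrite (dual_glue_inr mx) (dual_glue_inr m'x) (@dual_glue_inr _ x); last first.
    exact: (etrans (dpt_add m m') mx).
  rewrite /= (cl_addl D_lift) /= ?dpt_pullback //.
  by rewrite (pullback_add _ mx m'x).
- have m'x : dpt m' = gclass f (inl x) by rewrite -mx.
  rewrite (dual_glue_inl mx) (dual_glue_inl m'x) (@dual_glue_inl _ x); last first.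
    exact: (etrans (dpt_add m m') mx).
  by rewrite /= cl_addr (pullback_add _ mx m'x).
- rewrite (dual_glue_inr mx) (@dual_glue_inr _ x) //.
  by rewrite /= (cl_scalel D_lift) (pullback_scale _ _ mx).
- rewrite (dual_glue_inl mx) (@dual_glue_inl _ x) //.
  by rewrite /= cl_scaler (pullback_scale _ _ mx).
Qed.

Lemma dual_of_gluing : pb_diffeomorphic (dual_bundle W) W'.
Proof.
exists dual_glue, (glue_swap (inv_map f)); split.
- split; first exact: smooth_dual_glue.
  exists dual_unglue; split; [exact: smooth_dual_unglue|exact: dual_glueK|].
  exact: dual_unglueK.
- split; first exact: (smooth_glue_swap (inv_mapKV f_inj)).
  exists (glue_swap f); split.
  + exact: (smooth_glue_swap (@inv_mapK _ _ _ f)).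
  + exact: (glue_swapK (inv_mapKV f_inj) (@inv_mapK _ _ _ f)).
  + exact: (glue_swapK (@inv_mapK _ _ _ f) (inv_mapKV f_inj)).
- exact: dual_glue_proj.
- exact: dual_glue_linear.
Qed.
End DualOfGluing.
End Lemmas.

Theorem lemma5p17 (R : realType) (B1 B2 : pseudo_bundle R)
    (fin1 : finite_dim_fibres B1) (fin2 : finite_dim_fibres B2)
    (Y : set (pb_base B1)) (f : subD Y -> pb_base B2)
    (f_smooth : smooth f) (f_inj : injective f)
    (ft : pb_total (restrict_bundle B1 Y) -> pb_total B2)
    (ft_lift : smooth_linear_lift B1 B2 f ft)
    (duals_diffeo :
      exists (Phi : pb_total (restrict_bundle (dual_bundle B1) Y) ->
                    pb_total (restrict_bundle (dual_bundle B2) (range f)))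
             (phi : subD Y -> subD (range f)),
        pb_diffeo (restrict_bundle (dual_bundle B1) Y)
                  (restrict_bundle (dual_bundle B2) (range f)) Phi phi /\
        forall a, dual_map ft_lift (Phi a) = sval a) :
  smooth (inv_map f) /\
  exists dual_lift : smooth_linear_lift (dual_bundle B2) (dual_bundle B1)
                       (inv_map f) (dual_map ft_lift),
    pb_diffeomorphic
      (dual_bundle (glue_bundle B1 B2 f_inj ft_lift))
      (glue_bundle (dual_bundle B2) (dual_bundle B1) (inv_map_inj f) dual_lift).
Proof.
have [Phi [phi [[[sPhi [Psi [sPsi PhiK PsiK]]] _ _ _] DPhi]]] := duals_diffeo.
have DE l : dual_map ft_lift l = sval (Psi l) by rewrite -DPhi PsiK.
have D_inj : injective (dual_map ft_lift).
  by move=> l l'; rewrite !DE => /sub_inj /(can_inj PsiK).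
have D_smooth : smooth (dual_map ft_lift).
  move=> n U p /sPsi hp.
  have {}hp : @plot R (dualD B1) n U (fun u => sval (Psi (p u))) := hp.
  by apply: (plot_eq hp) => u _; rewrite /= DE.
split.
  move=> n U z hz.
  (* inv_map f is ft* on the zero section, followed by the projection *)
  have h0 := smooth_zero (p := restrict_bundle (dual_bundle B2) (range f)) hz.
  have [hD _] := D_smooth _ _ _ h0.
  by apply: (plot_eq hD) => u _; congr (inv_map f _); exact: sub_inj.
have D_lift : smooth_linear_lift (dual_bundle B2) (dual_bundle B1)
    (inv_map f) (dual_map ft_lift).
  by split=> //; exact: dual_map_linear.
exists D_lift; exact: (dual_of_gluing f_inj sPhi DPhi D_inj).
Qed.
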